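(* Let $\Omega_1,\dots,\Omega_m$ be mutually disjoint measurable subsets of $\hat G$ with finite and non-zero Haar measure, and let $\Omega=\bigcup_{i=1}^m\Omega_i$. Let $\Lambda_i\subset G$ ($1\le i\le m$) be countable sets such that for every $1\le i\le m$ the pair $(\Omega_i,\Lambda_i)$ is a Riesz spectral pair with Riesz constants $L_i$ (lower) and $U_i$ (upper). Let $A\subset\mathrm{Aut}(G)$ be countable and assume that $\Omega$ is a multiplicative tiling for $\hat G$ with respect to $A$, i.e. $\sum_{\alpha\in A}1_{\hat\alpha(\Omega)}(\xi)=1$ for a.e. $\xi\in\hat G$. Then $\Omega_1,\dots,\Omega_m$ is a Riesz wavelet collection of sets for $L^2(G)$; namely, the family $$\bigcup_{i=1}^m\{\psi_{i,\lambda,\alpha}:\lambda\in\Lambda_i,\ \alpha\in A\}$$ is a Riesz basis for $L^2(G)$, where $\hat\psi_i=1_{\Omega_i}$ and $\psi_{i,\lambda,\alpha}(x)=\Delta(\alpha)^{1/2}\psi_i(\alpha(x)-\lambda)$. The Riesz constants in this case are given by $L:=\min_i L_i$ and $U:=\max_i U_i$.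
   Context: $(G,+)$ is an infinite, non-discrete, second countable locally compact abelian (LCA) group with identity $e$, which admits a lattice (a discrete co-compact subgroup); $\hat G$ is its dual group. $m_G$ and $m_{\hat G}$ are Haar measures on $G$ and $\hat G$, normalized so that the Fourier transform $\hat f(\xi)=\int_G f(x)\overline{\langle \xi,x\rangle}\,dm_G(x)$ extends to a unitary map $L^2(G)\to L^2(\hat G)$. $\mathrm{Aut}(G)$ is the group of topological automorphisms of $G$. The modular function $\Delta:\mathrm{Aut}(G)\to(0,\infty)$ is defined by $m_G(\alpha(E))=\Delta(\alpha)m_G(E)$ for measurable $E\subset G$; it is assumed that $\Delta$ is not identically $1$. For $\alpha\in\mathrm{Aut}(G)$ the adjoint automorphism $\hat\alpha\in \mathrm{Aut}(\hat G)$ is defined by $\langle\hat\alpha(\xi),x\rangle=\langle\xi,\alpha(x)\rangle$. A countable family $\{x_n\}_{n\in I}$ in a Hilbert space $\mathcal H$ is a Riesz basis with Riesz constants $0<L\le U<\infty$ if its linear span is dense in $\mathcal H$ and $L\sum_n|c_n|^2\le\|\sum_n c_nx_n\|^2\le U\sum_n|c_n|^2$ for every finite sequence $\{c_n\}$ (here $L,U$ are admissible lower and upper bounds). For $t\in G$ write $\chi_t(\xi)=\langle\xi,t\rangle$, $\xi\in\hat G$. For measurable $E\subset\hat G$ of non-zero measure and countable $T\subset G$, $(E,T)$ is a Riesz spectral pair with Riesz constants $L,U$ if the family $\{\chi_t:t\in T\}$ (restricted to $E$) is a Riesz basis for $L^2(E)$ with Riesz constants $L,U$. A family of measurable subsets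 $\Omega_1,\dots,\Omega_m$ of $\hat G$ is a Riesz wavelet collection of sets for $L^2(G)$ if there are countable $A\subset\mathrm{Aut}(G)$ and countable $\Lambda_i\subset G$ such that the family $\{\psi_{i,\lambda,\alpha}\}$, indexed by the triples $(i,\lambda,\alpha)$ with $1\le i\le m$, $\lambda\in\Lambda_i$, $\alpha\in A$, is a Riesz basis for $L^2(G)$. *)

(* Defs.v *)
From HB Require Import structures.
From mathcomp Require Import all_boot all_order all_algebra finmap.
From mathcomp Require Import complex.
From mathcomp Require Import all_classical all_reals all_analysis.
From mathcomp Require Import ring.

Set Implicit Arguments.
Unset Strict Implicit.
Unset Printing Implicit Defensive.

Import Order.TTheory GRing.Theory Num.Theory.
Import numFieldNormedType.Exports.
Import Normc.

Local Open Scope classical_set_scope.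
Local Open Scope ring_scope.
Local Open Scope complex_scope.

Definition borel (G : topologicalZmodType) : Type := G.

HB.instance Definition _ (G : topologicalZmodType) := Choice.on (borel G).
HB.instance Definition _ (G : topologicalZmodType) :=
  isPointed.Build (borel G) (0 : G).
HB.instance Definition _ (G : topologicalZmodType) :=
  Measurable.copy (borel G)
    (g_sigma_algebraType (@open G : set (set (borel G)))).

Definition discrete_space (T : topologicalType) := forall A : set T, open A.

Definition lca_group (G : topologicalZmodType) :=
  hausdorff_space G /\ locally_compact [set: G].

Definition is_lattice (G : topologicalZmodType) (Gamma : zmodClosed G) :=
  discrete_space (set_type [set x : G | x \in Gamma]) /\
  compact [set: quotient_topology (Quotient.quot Gamma)].

Record haar_measure (R : realType) (G : topologicalZmodType)
    (m : {measure set (borel G) -> \bar R}) : Prop := HaarMeasure {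
  haar_translation : forall (x : G) (E : set (borel G)), measurable E ->
    m ((fun y : G => x + y) @` E) = m E ;
  haar_neq0 : m [set: borel G] != 0%E ;
  haar_compact : forall K : set G, compact K -> (m K < +oo)%E ;
  haar_outer : forall E : set (borel G), measurable E ->
    m E = ereal_inf [set m V | V in [set V : set G | open V /\ E `<=` V]] ;
  haar_inner : forall V : set G, open V ->
    m V = ereal_sup [set m K | K in [set K : set G | compact K /\ K `<=` V]]
}.

(* The group law of the dual, pointwise multiplication of characters, is
   written additively. The topology is the compact-open one. [R[i]] itself
   carries no topology in the library, hence [R[i]^o]. *)
Section DualGroup.
Variables (R : realType) (G : topologicalZmodType).

Record dual_group := Character {
  character :> G -> R[i] ;
  character_norm : forall x, `|character x| = 1 ;
  characterD : forall x y, character (x + y) = character x * character y ;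
  character_cont : continuous (character : G -> R[i]^o) }.

Lemma dual_ext (xi eta : dual_group) : xi =1 eta -> xi = eta.
Proof.
case: xi eta => [f nf fD fc] [g ng gD gc] /= /funext fg.
by case: _ / fg in ng gD gc *; congr Character; exact: Prop_irrelevance.
Qed.

Lemma character_neq0 (xi : dual_group) x : xi x != 0.
Proof. by rewrite -normr_eq0 character_norm oner_neq0. Qed.

Fact dual_one_norm (x : G) : `|1 : R[i]| = 1. Proof. exact: normr1. Qed.
Fact dual_oneD (x y : G) : 1 = 1 * 1 :> R[i]. Proof. by rewrite mulr1. Qed.
Fact dual_one_cont : continuous ((fun=> 1) : G -> R[i]^o).
Proof. by move=> x; exact: cvg_cst. Qed.
Definition dual_one := Character dual_one_norm dual_oneD dual_one_cont.

Section dual_operations.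
Variables xi eta : dual_group.

Fact dual_mul_norm x : `|xi x * eta x| = 1.
Proof. by rewrite normrM !character_norm mulr1. Qed.
Fact dual_mulD x y :
  xi (x + y) * eta (x + y) = (xi x * eta x) * (xi y * eta y).
Proof. by rewrite !characterD mulrACA. Qed.
Fact dual_mul_cont : continuous ((fun x => xi x * eta x) : G -> R[i]^o).
Proof. by move=> x; apply: (@cvgM R[i]); exact: character_cont. Qed.
Definition dual_mul := Character dual_mul_norm dual_mulD dual_mul_cont.

Fact dual_inv_norm x : `|(xi x)^-1| = 1.
Proof. by rewrite normfV character_norm invr1. Qed.
Fact dual_invD x y : (xi (x + y))^-1 = (xi x)^-1 * (xi y)^-1.
Proof. by rewrite characterD invfM. Qed.
Fact dual_inv_cont : continuous ((fun x => (xi x)^-1) : G -> R[i]^o).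
Proof.
move=> x; apply: (@cvgV R[i]); first exact: character_neq0.
exact: character_cont.
Qed.
Definition dual_inv := Character dual_inv_norm dual_invD dual_inv_cont.

End dual_operations.

HB.instance Definition _ := gen_eqMixin dual_group.
HB.instance Definition _ := gen_choiceMixin dual_group.

Fact dual_mulA : associative dual_mul.
Proof. by move=> a b c; apply: dual_ext => x /=; rewrite mulrA. Qed.
Fact dual_mulC : commutative dual_mul.
Proof. by move=> a b; apply: dual_ext => x /=; rewrite mulrC. Qed.
Fact dual_mul1 : left_id dual_one dual_mul.
Proof. by move=> a; apply: dual_ext => x /=; rewrite mul1r. Qed.
Fact dual_mulV : left_inverse dual_one dual_inv dual_mul.
Proof.
by move=> a; apply: dual_ext => x /=; rewrite mulVf// character_neq0.
Qed.
HB.instance Definition _ :=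
  GRing.isZmodule.Build dual_group dual_mulA dual_mulC dual_mul1 dual_mulV.

Definition dual_incl (xi : dual_group) : {compact-open, G -> R[i]^o} := xi.

HB.instance Definition _ :=
  Topological.copy dual_group (initial_topology dual_incl).

Lemma cvg_dualP (F : set_system dual_group) (xi : dual_group) : Filter F ->
  F --> xi <->
  forall (K : set G) (e : R[i]), compact K -> 0 < e ->
    \forall eta \near F, forall x, K x -> `|xi x - (eta : dual_group) x| < e.
Proof.
move=> FF.
have H1 : F --> xi <-> dual_incl @ F --> dual_incl xi.
  split=> [Fxi|Fxi A].
    apply: cvg_trans; last exact: (@initial_continuous _ _ dual_incl xi).
    exact: cvg_app.
  move=> [B [[C oC <-] Cxi CA]].
  by apply: filterS CA _; apply: Fxi; exact: open_nbhs_nbhs.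
have H2 : dual_incl @ F --> dual_incl xi <->
    {family compact, dual_incl @ F --> (xi : G -> R[i]^o)}.
  by apply: compact_open_fam_compactP; exact: character_cont.
rewrite H1 H2 fam_cvgP; split.
  move=> Fxi K e cK e0.
  apply: (Fxi K cK [set h | forall x, K x -> `|xi x - h x| < e]).
  apply/uniform_nbhs; exists [set p | ball p.1 e p.2]; split.
    by rewrite -entourage_ballE; exists e.
  by move=> h /= Kh x Kx; exact: Kh.
move=> Fxi K cK A /uniform_nbhs[E [entE EA]].
have [e /= e0 eE] : entourage_ (@ball _ R[i]^o) E by rewrite entourage_ballE.
have := Fxi K e cK e0; apply: filterS => eta Keta.
by apply: EA => x Kx; apply: (eE (_, _)); exact: Keta.
Qed.

Fact dual_sub_continuous :
  continuous (fun p : dual_group * dual_group => p.1 - p.2).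
Proof.
move=> [xi eta]; apply/cvg_dualP => K e cK e0.
have e20 : 0 < e / 2 by rewrite divr_gt0.
have nx := (cvg_dualP xi (nbhs_filter xi)).1 cvg_id K _ cK e20.
have ny := (cvg_dualP eta (nbhs_filter eta)).1 cvg_id K _ cK e20.
exists ([set z : dual_group | forall x, K x -> `|xi x - z x| < e / 2],
        [set z : dual_group | forall x, K x -> `|eta x - z x| < e / 2]).
  by split; [exact: nx|exact: ny].
move=> [a b] /= [Ha Hb] x Kx.
have E : xi x / eta x - a x / b x =
    (xi x - a x) / eta x - a x * (eta x - b x) / (eta x * b x).
  by field; rewrite !character_neq0.
rewrite [X in `|X| < e]E (splitr e).
apply: (le_lt_trans (ler_normB _ _)).
rewrite !(normrM, normfV) !character_norm invr1 !mulr1 mul1r.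
by rewrite divr1; apply: ltrD; [exact: Ha|exact: Hb].
Qed.

HB.instance Definition _ :=
  PreTopologicalNmodule_isTopologicalZmodule.Build dual_group dual_sub_continuous.

End DualGroup.

Section automorphisms.
Variable G : topologicalZmodType.

Record aut := Aut {
  aut_fun :> G -> G ;
  aut_inv : G -> G ;
  autD : forall x y, aut_fun (x + y) = aut_fun x + aut_fun y ;
  autK : cancel aut_fun aut_inv ;
  aut_invK : cancel aut_inv aut_fun ;
  aut_cont : continuous aut_fun ;
  aut_inv_cont : continuous aut_inv }.

Lemma aut_ext (a b : aut) : a =1 b -> a = b.
Proof.
move=> ab; have abV : aut_inv a = aut_inv b.
  by apply/funext => x; rewrite -{1}(aut_invK b x) -ab autK.
case: a b ab abV => [f g fD fK gK fc gc] [f' g' fD' fK' gK' fc' gc'] /=.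
move=> /funext ff' gg'; case: _ / ff' in fD' fK' gK' fc' *.
case: _ / gg' in fK' gK' gc' *.
by congr Aut; exact: Prop_irrelevance.
Qed.

HB.instance Definition _ := gen_eqMixin aut.
HB.instance Definition _ := gen_choiceMixin aut.

Lemma aut_invD (a : aut) x y : aut_inv a (x + y) = aut_inv a x + aut_inv a y.
Proof. by apply: (can_inj (autK a)); rewrite autD !aut_invK. Qed.

Definition aut_sym (a : aut) :=
  Aut (aut_invD a) (@aut_invK a) (@autK a)
    (@aut_inv_cont a) (@aut_cont a).

End automorphisms.

Section adjoint.
Variables (R : realType) (G : topologicalZmodType).

Section adjoint_fun.
Variables (a : aut G) (xi : dual_group R G).
Fact adjoint_norm x : `|xi (a x)| = 1. Proof. exact: character_norm. Qed.
Fact adjointD x y : xi (a (x + y)) = xi (a x) * xi (a y).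
Proof. by rewrite autD characterD. Qed.
Fact adjoint_char_cont : continuous ((fun x => xi (a x)) : G -> R[i]^o).
Proof.
move=> x; apply: (@continuous_comp G G R[i]^o a xi).
  exact: aut_cont.
exact: character_cont.
Qed.
Definition adjoint_fun := Character adjoint_norm adjointD adjoint_char_cont.
End adjoint_fun.

Fact adjoint_funD (a : aut G) xi eta :
  adjoint_fun a (xi + eta) = adjoint_fun a xi + adjoint_fun a eta.
Proof. exact: dual_ext. Qed.

Fact adjoint_funK (a : aut G) :
  cancel (adjoint_fun a) (adjoint_fun (aut_sym a)).
Proof. by move=> xi; apply: dual_ext => x /=; rewrite aut_invK. Qed.

Fact adjoint_fun_symK (a : aut G) :
  cancel (adjoint_fun (aut_sym a)) (adjoint_fun a).
Proof. by move=> xi; apply: dual_ext => x /=; rewrite autK. Qed.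

Fact adjoint_fun_cont (a : aut G) : continuous (adjoint_fun a).
Proof.
move=> xi.
have Fxi := fmap_filter (adjoint_fun a) (nbhs_filter xi).
apply/(cvg_dualP (adjoint_fun a xi) Fxi) => K e cK e0.
have caK : compact (a @` K).
  apply: continuous_compact => //; apply: continuous_subspaceT.
  exact: aut_cont.
have := (cvg_dualP xi (nbhs_filter xi)).1 cvg_id (a @` K) _ caK e0.
by apply: filterS => eta H x Kx /=; apply: H; exists x.
Qed.

Definition adjoint (a : aut G) : aut (dual_group R G) :=
  Aut (adjoint_funD a) (@adjoint_funK a) (@adjoint_fun_symK a)
    (@adjoint_fun_cont a) (@adjoint_fun_cont (aut_sym a)).

End adjoint.

Section L2_space.
Context d (T : measurableType d) (R : realType).
Variables (mu : {measure set T -> \bar R}) (D : set T).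
Implicit Types f g : T -> R[i].

Definition cmeasurable f :=
  measurable_fun D (fun x => complex.Re (f x)) /\ measurable_fun D (fun x => complex.Im (f x)).

Definition cintegral f : R[i] :=
  (\int[mu]_(x in D) complex.Re (f x)) +i* (\int[mu]_(x in D) complex.Im (f x)).

Definition L1 : set (T -> R[i]) :=
  [set f | cmeasurable f /\
    (\int[mu]_(x in D) (normc (f x))%:E < +oo)%E].

(* Square-integrable functions on [D], not their classes: [l2norm] is only a
   seminorm, and equality in the Hilbert space is equality almost
   everywhere. *)
Definition L2 : set (T -> R[i]) :=
  [set f | cmeasurable f /\
    (\int[mu]_(x in D) (normc (f x) ^+ 2)%:E < +oo)%E].

Definition l2dot f g : R[i] := cintegral (fun x => f x * (g x)^*).

Definition l2norm f : R :=
  Num.sqrt (\int[mu]_(x in D) (normc (f x) ^+ 2)).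

End L2_space.

(* The Hilbert space is given as a subspace [H] of [V] with a seminorm. *)
Definition riesz_basis (R : realType) (V : lmodType R[i]) (H : set V)
    (norm : V -> R) (I : choiceType) (D : set I) (x : I -> V) (L U : R) :=
  [/\ 0 < L <= U,
      countable D,
      forall n, D n -> H (x n),
      forall v, H v -> forall e : R, 0 < e ->
        exists (J : {fset I}) (c : I -> R[i]),
          [set` J] `<=` D /\ norm (v - \sum_(n <- J) c n *: x n) < e &
      forall (J : {fset I}) (c : I -> R[i]), [set` J] `<=` D ->
        L * \sum_(n <- J) normc (c n) ^+ 2
          <= norm (\sum_(n <- J) c n *: x n) ^+ 2
          <= U * \sum_(n <- J) normc (c n) ^+ 2].

Section wavelets.
Variables (R : realType) (G : topologicalZmodType).
Local Notation Ghat := (dual_group R G).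
Variables (mG : {measure set (borel G) -> \bar R}).
Variables (mGhat : {measure set (borel Ghat) -> \bar R}).

Definition fourier (f : G -> R[i]) (xi : Ghat) : R[i] :=
  cintegral mG [set: borel G] (fun x => f x * (xi x)^*).

(* [F] is the unitary extension of the Fourier transform to L^2; the existence
   of such an [F] is the normalization of the pair of Haar measures. *)
Record fourier_plancherel (F : (G -> R[i]) -> (Ghat -> R[i])) : Prop :=
  FourierPlancherel {
  plancherel_L2 : forall f,
    L2 mG setT f -> L2 mGhat setT (F f) ;
  plancherel_linear : forall (c : R[i]) f g,
    L2 mG setT f -> L2 mG setT g ->
    {ae mGhat, forall xi, F (c *: f + g) xi = c * F f xi + F g xi} ;
  plancherel_dot : forall f g,
    L2 mG setT f -> L2 mG setT g ->
    l2dot mGhat setT (F f) (F g) = l2dot mG setT f g ;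
  plancherel_surj : forall h, L2 mGhat setT h ->
    exists2 f, L2 mG setT f & {ae mGhat, forall xi, F f xi = h xi} ;
  plancherel_fourier : forall f, L1 mG setT f -> L2 mG setT f ->
    {ae mGhat, forall xi, F f xi = fourier f xi} }.

Definition modular_function (Delta : aut G -> R) :=
  forall a : aut G, 0 < Delta a /\
    forall E : set (borel G), measurable E ->
      mG (a @` E) = ((Delta a)%:E * mG E)%E.

Definition evaluation (t : G) : Ghat -> R[i] := fun xi => xi t.

Definition riesz_spectral_pair (E : set (borel Ghat)) (T : set G) (L U : R) :=
  [/\ measurable E, mGhat E != 0%E, countable T &
      riesz_basis (L2 mGhat E) (l2norm mGhat E) T evaluation L U].

Definition multiplicative_tiling (Omega : set Ghat) (A : set (aut G)) :=
  {ae mGhat, forall xi,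
    \esum_(a in A) (\1_(adjoint R a @` Omega) xi)%:E = 1%E :> \bar R}.

Section family.
Variables (F : (G -> R[i]) -> (Ghat -> R[i])) (Delta : aut G -> R) (n : nat).

Definition wavelet_generators (Omega : 'I_n -> set Ghat)
    (psi : 'I_n -> G -> R[i]) :=
  forall i, L2 mG setT (psi i) /\
    {ae mGhat, forall xi, F (psi i) xi = \1_(Omega i) xi}.

Definition wavelet_index (Lambda : 'I_n -> set G) (A : set (aut G)) :
    set ('I_n * G * aut G) :=
  [set p | Lambda p.1.1 p.1.2 /\ A p.2].

Definition wavelet (psi : 'I_n -> G -> R[i]) (p : 'I_n * G * aut G) :
    G -> R[i] :=
  fun x => (Num.sqrt (Delta p.2))%:C * psi p.1.1 (p.2 x - p.1.2).

Definition riesz_wavelet_collection (Omega : 'I_n -> set (borel Ghat)) :=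
  (forall i, measurable (Omega i)) /\
  exists (A : set (aut G)) (Lambda : 'I_n -> set G)
         (psi : 'I_n -> G -> R[i]) (L U : R),
    [/\ countable A, forall i, countable (Lambda i),
        wavelet_generators Omega psi &
        riesz_basis (L2 mG setT) (l2norm mG setT)
          (wavelet_index Lambda A) (wavelet psi) L U].

End family.
End wavelets.

(* Main.v *)
Require Import Defs.
From HB Require Import structures.
From mathcomp Require Import all_boot all_order all_algebra finmap.
From mathcomp Require Import complex.
From mathcomp Require Import all_classical all_reals all_analysis.
From mathcomp Require Import measurable_realfun.
From mathcomp Require Import ring lra.

(** The Fourier transform carries the wavelet with parameters [(i, t, a)] to the
    conjugate character at [t] on [Omega i], transplanted by the adjoint of [a]
    to the set [adjoint a @` Omega i] and normalized. This transplantation is an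
    isometry from L2 of [Omega i] onto L2 of its image, because the adjoint of
    [a] scales the dual Haar measure by the same factor [Delta a] as [a] scales
    the Haar measure of [G]. By hypothesis the images tile the dual group, so L2
    of the dual group is the orthogonal sum of the spaces of the tiles
    ([nsq_sum_disjoint]). The transformed wavelets of one tile form a copy of a
    Riesz basis with bounds [L i] and [U i]; together they form a Riesz basis
    with the minimum and the maximum of these bounds ([dual_wavelet_bounds],
    [approximable_dual_wavelet]), and the Plancherel isometry takes it back to
    [G].

    The analysis behind this is the equality of the two moduli and the formula
    for the transform of a wavelet. Both the dual Haar measure and its image
    under an adjoint automorphism are translation invariant, and Fubini's theorem
    shows that two such sigma-finite measures are proportional
    ([invariant_measures_proportional]). For the addition of the dual group to be
    measurable with respect to the product of the Borel sigma-algebras, the dual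
    group has to be second countable, which follows from second countability and
    local compactness of [G] ([second_countable_dual]). A change of variables
    gives the transform of a dilated and translated integrable function
    ([fourier_dilate]); comparing norms before and after the transform identifies
    the constant of proportionality as [Delta a] ([dual_modulus]). Since the
    adjoint thus preserves null sets, the formula makes sense for classes of
    functions and extends from integrable to all square-integrable functions by
    density ([F_dilate]). *)

Set Implicit Arguments.
Unset Strict Implicit.
Unset Printing Implicit Defensive.

Import Order.TTheory GRing.Theory Num.Theory.
Import numFieldNormedType.Exports.
Import Normc.

Local Open Scope classical_set_scope.
Local Open Scope ring_scope.

(** * Second countability of the dual group *)

Lemma complex_rat_dense (R : realType) (z : R[i]) (e : R) : 0 < e ->
  exists p : rat * rat, `|z - ((ratr p.1) +i* (ratr p.2))%C| < e%:C%C.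
Proof.
move=> e0; case: z => a b.
have e20 : 0 < e / 2 by rewrite divr_gt0.
have [|q qa] := @rat_in_itvoo _ (a - e/2) (a + e/2); first by lra.
have [|r rb] := @rat_in_itvoo _ (b - e/2) (b + e/2); first by lra.
exists (q, r); rewrite normc_def /= ltcR.
move: qa rb; rewrite !in_itv /= => /andP[? ?] /andP[? ?].
rewrite -[X in _ < X](ger0_norm (ltW e0)) -sqrtr_sqr ltr_sqrt ?exprn_gt0 //.
nra.
Qed.

(** Subbasic open sets of the compact-open topology, with a rational centre and
    a radius [1/(n+1)] so that countably many basic sets [i.1] yield countably many
    of them. *)
Definition tube (R : realType) (G : topologicalZmodType)
    (i : set G * (rat * rat * nat)) : set (dual_group R G) :=
  [set xi | forall x, closure i.1 x ->
    `|xi x - ((ratr i.2.1.1) +i* (ratr i.2.1.2))%C| < (i.2.2.+1%:R^-1)%:C%C].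

Lemma tube_open (R : realType) (G : topologicalZmodType)
    (i : set G * (rat * rat * nat)) :
  compact (closure i.1) -> open (@tube R G i).
Proof.
move=> ci.
pose q : R[i]^o := ((ratr i.2.1.1) +i* (ratr i.2.1.2))%C.
have := @compact_open_open G R[i]^o (closure i.1)
  (ball q (i.2.2.+1%:R^-1)%:C%C) ci (ball_open _ _).
move=> oU.
have := (continuousP (@dual_incl R G : dual_group R G -> _)).1
  (@initial_continuous _ _ (@dual_incl R G)) _ oU.
congr open; apply/seteqP; split=> xi /= H.
  by move=> x ix; rewrite distrC; apply: (H (xi x)); exists x.
move=> _ [x ix <-]; rewrite -ball_normE /= distrC; exact: H.
Qed.

(** Around each point of a compact set [K], a character is nearly constant on
    the closure of a small basic open set, hence lies in a tube whose elements
    are all close to it there. Compactness, in its near-covering form, turns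
    these local statements into uniform closeness on [K]. Regularity of [G] and
    local compactness give the basic sets with compact closure. *)
Lemma second_countable_dual (R : realType) (G : topologicalZmodType) :
  lca_group G -> @second_countable G -> @second_countable (dual_group R G).
Proof.
move=> [hG lG] [B cB [oB Bx]].
pose D := [set i : set G * (rat * rat * nat) | B i.1 /\ compact (closure i.1)].
exists (finI_from D (@tube R G)).
  apply: finI_from_countable.
  apply: (@sub_countable _ _ _ (B `*` setT)); last exact: countableX.
  by apply: subset_card_le => i [].
split.
  move=> _ [D' D'D <-]; rewrite openE => xi xiD'.
  apply: filter_bigI => i iD'; apply: open_nbhs_nbhs; split; last exact: xiD'.
  by apply: tube_open; have := D'D _ iD'; rewrite inE => -[].
move=> xi.
have FF : Filter (filter_from [set U | finI_from D (@tube R G) U /\ U xi] id).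
  apply: filter_from_filter.
    exists setT; split=> //; exists fset0 => //.
    by rewrite -subTset => x _ i /=.
  move=> U V [FU Ux] [FV Vx]; exists (U `&` V) => //; split=> //.
  exact: finI_fromI.
apply/cvg_dualP => K e cK e0.
have [er er0 ->] : exists2 er : R, 0 < er & e = er%:C%C.
  case: e e0 => a b; rewrite ltcE /= => /andP[/eqP -> a0].
  by exists a.
apply: (compact_near_coveringP K).1 => // x Kx.
have er20 : 0 < er / 2 by rewrite divr_gt0.
have [n nr] : exists n, n.+1%:R^-1 < er / 2.
  by have [n] := ltr_add_invr er20; rewrite add0r; exists n.
have n0 : (0 : R) < n.+1%:R^-1 by rewrite invr_gt0.
have [q qx] := complex_rat_dense (xi x) n0.
pose c : R[i]^o := ((ratr q.1) +i* (ratr q.2))%C.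
have xiN : nbhs x [set y | `|xi y - c| < (n.+1%:R^-1)%:C%C].
  have oV := (continuousP (xi : G -> R[i]^o)).1 (@character_cont _ _ xi) _
    (ball_open c (n.+1%:R^-1)%:C%C).
  have cx : ball c (n.+1%:R^-1)%:C%C (xi x : R[i]^o).
    by rewrite -ball_normE /= distrC.
  have := open_nbhs_nbhs (conj oV cx).
  by apply: filterS => y; rewrite /= -ball_normE /= distrC.
have [V xV' [VK clV]] := lG x I.
have xV : nbhs x V.
  by move: xV'; rewrite /within /=; apply: filterS => y; apply.
have [A Ax cA] := compact_regular hG VK xV xiN.
have [U [BU Ux] UAV] := Bx x _ (filterI Ax xV).
have DU : D (U, (q, n)).
  split => //=.
  apply: (subclosed_compact _ VK); first exact: closed_closure.
  rewrite [X in _ `<=` X](closure_id V).1 //.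
  by apply: closureS => y /UAV[].
exists (U, @tube R G (U, (q, n))).
  split=> /=; first by apply: open_nbhs_nbhs; split => //; exact: oB.
  exists (@tube R G (U, (q, n))) => //; split; first exact: finI_from1.
  by move=> y Uy; apply: cA; apply: closureS Uy => z /UAV[].
move=> [y eta] [/= Uy] /(_ y (subset_closure Uy)) /= ye.
have ty : `|xi y - c| < n.+1%:R^-1%:C%C.
  by apply: cA; apply: subset_closure; have [] := UAV _ Uy.
rewrite (_ : xi y - eta y = (xi y - c) - (eta y - c)); last by ring.
apply: (le_lt_trans (ler_normB _ _)).
apply: lt_trans (ltrD ty ye) _.
by rewrite -(rmorphD (real_complex R)) /= ltcR (splitr er); exact: ltrD.
Qed.

(** * Invariant Borel measures on second countable groups *)

Lemma measurable_continuous (G H : topologicalZmodType) (f : G -> H) :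
  continuous f -> measurable_fun [set: borel G] (f : borel G -> borel H).
Proof.
move=> /continuousP cf.
apply: (@measurability _ _ (borel G) (borel H) _ _ (@open H)) => //.
by move=> _ [U oU <-]; rewrite setTI; apply: sub_sigma_algebra; exact: cf.
Qed.

Lemma measurable_open (G : topologicalZmodType) (U : set G) :
  open U -> measurable (U : set (borel G)).
Proof. by move=> oU; exact: sub_sigma_algebra. Qed.

Lemma countable_enum (T : Type) (D : set T) (x0 : T) :
  countable D -> D x0 -> exists e : nat -> T, D = range e.
Proof.
move=> /countable_injP[f fi] Dx0.
have h n : exists x, D x /\ ((exists2 y, D y & f y = n) -> f x = n).
  have [[y Dy <-]|H] := pselect (exists2 y, D y & f y = n); first by exists y.
  by exists x0; split.
have [e eP] := choice h; exists e; apply/seteqP; split=> [x Dx|_ [n _ <-]].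
  exists (f x) => //; have [De /(_ (ex_intro2 _ _ x Dx erefl))] := eP (f x).
  by apply: fi; rewrite inE.
by have [] := eP n.
Qed.

Lemma measurable_bigcup_countable d (T : measurableType d) (I : Type)
    (D : set I) (F : I -> set T) :
  countable D -> (forall i, D i -> measurable (F i)) ->
  measurable (\bigcup_(i in D) F i).
Proof.
move=> cD mF.
have [->|/set0P[x0 Dx0]] := eqVneq D set0; first by rewrite bigcup_set0.
have [e De] := countable_enum cD Dx0.
rewrite De bigcup_image; apply: bigcupT_measurable => n; apply: mF.
by rewrite De; exists n.
Qed.

(** An open set of a product of second countable spaces is a countable union of
    open boxes, hence belongs to the product of the Borel sigma-algebras. *)
Lemma measurable_fun_continuous2 (G H K : topologicalZmodType)
    (f : G * H -> K) :
  @second_countable G -> @second_countable H -> continuous f ->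
  measurable_fun [set: borel G * borel H] (f : borel G * borel H -> borel K).
Proof.
move=> [A cA [oA Ax]] [B cB [oB Bx]] /continuousP cf.
apply: (@measurability _ _ (borel G * borel H)%type (borel K) _ _
  (@open K)) => //.
move=> _ [U oU <-]; rewrite setTI.
have oV := cf _ oU.
set V := f @^-1` U in oV *.
pose boxes := [set p | [/\ A p.1, B p.2 & p.1 `*` p.2 `<=` V]].
have -> : V = \bigcup_(p in boxes) (p.1 `*` p.2).
  apply/seteqP; split=> [[x y] Vxy|[x y] [[P Q] [_ _ sV] /= PQ]]; last first.
    exact: sV.
  have [[P Q] /= [Px Qy] PQ] := (open_nbhs_nbhs (conj oV Vxy)).
  have [P' [AP' P'x] P'P] := Ax _ _ Px.
  have [Q' [AQ' Q'x] Q'Q] := Bx _ _ Qy.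
  exists (P', Q') => //; split => // -[u v] /= [Pu Qv]; apply: PQ; split => /=.
    exact: P'P.
  exact: Q'Q.
apply: measurable_bigcup_countable.
  apply: (@sub_countable _ _ _ (A `*` B)); last exact: countableX.
  by apply: subset_card_le => p [].
move=> [P Q] [/= AP BQ _]; apply: measurableX; apply: measurable_open.
  exact: oA.
exact: oB.
Qed.

(** Lets Fubini's theorem apply to a measure whose sigma-finiteness is a
    hypothesis. *)
Lemma sigma_finite_bundle (R : realType) d (T : measurableType d)
    (m : {measure set T -> \bar R}) : sigma_finite setT m ->
  exists m' : {sigma_finite_measure set T -> \bar R},
    m = m' :> {measure set T -> \bar R}.
Proof.
move=> sm.
pose H1 := isSFinite.Build _ _ _ _ (sfinite_measure_sigma_finite sm).
pose H2 := isSigmaFinite.Build _ _ _ _ sm.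
exists (HB.pack_for (SigmaFiniteMeasure.type T R) (Measure.sort m) H1 H2).
exact: eq_measure.
Qed.

Section fubini.
Variables (R : realType) (d1 d2 : measure_display).
Variables (T1 : measurableType d1) (T2 : measurableType d2).

Variables (m1 : {measure set T1 -> \bar R}) (m2 : {measure set T2 -> \bar R}).
Hypotheses (s1 : sigma_finite setT m1) (s2 : sigma_finite setT m2).

Lemma fubini_sections (S : set (T1 * T2)) : measurable S ->
  (\int[m1]_x m2 [set y | S (x, y)] = \int[m2]_y m1 [set x | S (x, y)])%E.
Proof.
have [m1' m1E] := sigma_finite_bundle s1.
have [m2' m2E] := sigma_finite_bundle s2.
rewrite m1E m2E => mS.
have mf : measurable_fun setT (EFin \o (\1_S : T1 * T2 -> R)).
  by apply/measurable_EFinP; exact: measurable_indic.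
have := @fubini_tonelli _ _ _ _ _ m1' m2' _ mf.
move=> H.
transitivity (\int[m1']_x (\int[m2']_y (\1_S (x, y))%:E))%E.
  apply: eq_integral => x _.
  have := @integral_indic _ _ _ m2' _ measurableT [set y | S (x, y)].
  rewrite setIT => <- //.
  rewrite [X in measurable X](_ : _ = xsection S x).
    exact: measurable_xsection.
  by apply/seteqP; split=> y; rewrite /xsection /= inE.
rewrite H; last by move=> x; rewrite lee_fin.
apply: eq_integral => y _.
have := @integral_indic _ _ _ m1' _ measurableT [set x | S (x, y)].
rewrite setIT => <- //.
rewrite [X in measurable X](_ : _ = ysection S y).
  exact: measurable_ysection.
by apply/seteqP; split=> x; rewrite /ysection /= inE.
Qed.
End fubini.

Definition translation_invariant (R : realType) (G : topologicalZmodType)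
    (m : set (borel G) -> \bar R) :=
  forall (x : G) (E : set (borel G)), measurable E ->
    m ((fun y : G => x + y) @` E) = m E.

Lemma measurable_fun_add (G : topologicalZmodType) :
  @second_countable G ->
  measurable_fun [set: borel G * borel G]
    ((fun p => (p.1 : G) + p.2) : borel G * borel G -> borel G).
Proof.
move=> cG.
apply: (@measurable_fun_continuous2 G G G (fun p => p.1 + p.2)) => //.
exact: add_continuous.
Qed.

Lemma measurable_fun_subC (G : topologicalZmodType) :
  @second_countable G ->
  measurable_fun [set: borel G * borel G]
    ((fun p => (p.2 : G) - p.1) : borel G * borel G -> borel G).
Proof.
move=> cG.
apply: (@measurable_fun_continuous2 G G G (fun p => p.2 - p.1)) => //.
move=> p; apply: (@continuous_comp _ _ _ (fun p : G * G => (p.2, p.1))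
  (fun p : G * G => p.1 - p.2)).
  by apply: cvg_pair => /=; [exact: cvg_snd|exact: cvg_fst].
exact: sub_continuous.
Qed.

(** Integrate the indicator of [E (x + y)] times that of [B y] over [n] in [x]
    and over [m] in [y]. Integrating in [x] first, invariance of [n] gives
    [m B * n E]. Integrating in [y] first, substituting [z = x + y] by
    invariance of [m] and then exchanging the integrals once more gives
    [m E * n (- B)]. *)
Lemma invariant_measures_proportional (R : realType) (G : topologicalZmodType)
    (m n : {measure set (borel G) -> \bar R}) (E B : set (borel G)) :
  @second_countable G -> sigma_finite setT m -> sigma_finite setT n ->
  translation_invariant m -> translation_invariant n ->
  measurable E -> measurable B ->
  (m B * n E = m E * n ((fun x : G => (- x)%R) @` B))%E.
Proof.
move=> cG sm sn tm tn mE mB.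
pose S1 : set (borel G * borel G) := [set p | E ((p.1 : G) + p.2) /\ B p.2].
pose S2 : set (borel G * borel G) := [set p | E p.2 /\ B ((p.2 : G) - p.1)].
have mS1 : measurable S1.
  apply: measurableI.
    by rewrite -[X in measurable X]setTI; exact: measurable_fun_add.
  by rewrite -[X in measurable X]setTI; exact: measurable_snd.
have mS2 : measurable S2.
  apply: measurableI.
    by rewrite -[X in measurable X]setTI; exact: measurable_snd.
  by rewrite -[X in measurable X]setTI; exact: measurable_fun_subC.
have mN : measurable ((fun x : G => (- x)%R) @` B : set (borel G)).
  rewrite (_ : _ @` _ = (fun x : G => (- x)%R) @^-1` B).
    rewrite -[X in measurable X]setTI.
    exact: (@measurable_continuous G G -%R (@opp_continuous G)).
  apply/seteqP; split=> [_ [x Bx <-]|x Bx]; first by rewrite /= opprK.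
  by exists (- x); rewrite ?opprK.
have S1E : (\int[n]_x m [set y | S1 (x, y)] = m B * n E)%E.
  rewrite fubini_sections //.
  transitivity (\int[m]_y (n E * (\1_B y)%:E))%E.
    apply: eq_integral => y _; rewrite indicE.
    have [yB|yB] := boolP (y \in B); last first.
      rewrite mule0 [X in n X](_ : _ = set0) ?measure0 // -subset0 => x [_ By].
      by rewrite notin_setE in yB.
    rewrite mule1 -(tn (- (y : G)) E) //; congr (n _).
    apply/seteqP; split=> [x /= [Exy _]|_ [x Ex <-] ].
      by exists ((x : G) + y) => //; rewrite addrC addrK.
    split; last by rewrite inE in yB.
    by rewrite /= addrC addNKr.
  rewrite ge0_integralZl //; last exact/measurable_EFinP/measurable_indic.
  by rewrite integral_indic // setIT muleC.
have S2E : (\int[n]_x m [set y | S2 (x, y)] =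
    m E * n ((fun x : G => (- x)%R) @` B))%E.
  rewrite fubini_sections //.
  transitivity (\int[m]_y (n ((fun x : G => (- x)%R) @` B) * (\1_E y)%:E))%E.
    apply: eq_integral => y _; rewrite indicE.
    have [yB|yB] := boolP (y \in E); last first.
      rewrite mule0 [X in n X](_ : _ = set0) ?measure0 // -subset0 => x [By _].
      by rewrite notin_setE in yB.
    rewrite mule1 -(tn (y : G)) //; congr (n _).
    apply/seteqP; split=> [x /= [_ Bx]|_ [_ [x Bx <-] <-] ].
      exists (- ((y : G) - x)); first by exists ((y : G) - x).
      by rewrite opprB addrC subrK.
    split; first by rewrite inE in yB.
    by rewrite /= opprB addrC subrK.
  rewrite ge0_integralZl //; last exact/measurable_EFinP/measurable_indic.
  by rewrite integral_indic // setIT muleC.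
rewrite -S1E -S2E; apply: eq_integral => x _.
rewrite -(tm (x : G)).
  congr (m _); apply/seteqP; split=> [_ [y [Exy By] <-]|y [Ey Byx]].
    by split => //=; rewrite addrC addKr.
  exists ((y : G) - x); last by rewrite addrC subrK.
  by split => //=; rewrite addrC subrK.
rewrite [X in measurable X](_ : _ = xsection S1 x).
  exact: measurable_xsection.
by apply/seteqP; split=> y; rewrite /xsection /= inE.
Qed.

Lemma continuous_addl (G : topologicalZmodType) (x : G) :
  continuous (fun y : G => x + y).
Proof.
move=> y; apply: (@continuous_comp _ _ _ (fun y : G => (x, y))
  (fun p : G * G => p.1 + p.2)); last exact: add_continuous.
by apply: cvg_pair => /=; [exact: cvg_cst|exact: cvg_id].
Qed.

Lemma translateE (G : topologicalZmodType) (x : G) (E : set G) :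
  (fun y => x + y) @` E = (fun y => - x + y) @^-1` E.
Proof.
apply/seteqP; split=> [_ [y Ey <-]|y Ey]; first by rewrite /= addKr.
by exists (- x + y) => //; rewrite addNKr.
Qed.

(** The translates of [V] cover [G], so the basic open sets of finite measure
    do, and there are countably many of them. *)
Lemma sigma_finite_invariant (R : realType) (G : topologicalZmodType)
    (m : {measure set (borel G) -> \bar R}) (V : set G) :
  @second_countable G -> translation_invariant m ->
  open V -> V !=set0 -> (m V < +oo)%E -> sigma_finite setT m.
Proof.
move=> [B cB [oB Bx]] tm oV [v0 Vv0] mV.
pose D := [set U | B U /\ (m U < +oo)%E].
have cov x : exists2 U, D U & U x.
  have oW : open ((fun y => (x - v0) + y) @` V).
    rewrite translateE; apply: open_comp => // y _; exact: continuous_addl.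
  have Wx : ((fun y => (x - v0) + y) @` V) x by exists v0 => //; rewrite subrK.
  have [U [BU Ux] UW] := Bx x _ (open_nbhs_nbhs (conj oW Wx)).
  exists U => //; split => //; apply: le_lt_trans mV.
  rewrite -(tm (x - v0) V); last exact: measurable_open.
  by apply: le_measure; rewrite ?inE //; apply: measurable_open => //;
     exact: oB.
have [U0 DU0 _] := cov 0.
have cD : countable D by apply: sub_countable cB; apply: subset_card_le => U [].
have [e De] := countable_enum cD DU0.
have DeP n : D (e n) by rewrite De; exists n.
exists e => [|n].
  apply/seteqP; split=> // x _; have [U] := cov x; rewrite De => -[n _ <-] enx.
  by exists n.
by have [Ben ?] := DeP n; split => //; apply: measurable_open; exact: oB.
Qed.

Lemma aut_imageE (G : topologicalZmodType) (a : aut G) (E : set G) :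
  a @` E = aut_inv a @^-1` E.
Proof.
apply/seteqP; split=> [_ [y Ey <-]|y Ey]; first by rewrite /= autK.
by exists (aut_inv a y) => //; rewrite aut_invK.
Qed.

Lemma measurable_aut_image (G : topologicalZmodType) (a : aut G)
  (E : set (borel G)) : measurable E -> measurable (a @` E : set (borel G)).
Proof.
move=> mE; rewrite aut_imageE -[X in measurable X]setTI.
exact: (measurable_continuous (@aut_inv_cont _ a)).
Qed.

Section automorphism_scaling.
Variables (R : realType) (G : topologicalZmodType).
Variables (m : {measure set (borel G) -> \bar R}).
Hypotheses (cG : @second_countable G) (tm : translation_invariant m).
Hypothesis (sm : sigma_finite setT m).
Variable (a : aut G).

Let ainv : borel G -> borel G := aut_inv a.
Let mainv : measurable_fun setT ainv.
Proof. exact: (measurable_continuous (@aut_inv_cont _ a)). Qed.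

Let nu : {measure set (borel G) -> \bar R} :=
  measure_function_pushforward__canonical__measure_function_Measure m mainv.

Let nuE E : nu E = m (a @` E).
Proof. by rewrite aut_imageE. Qed.

Let tnu : translation_invariant nu.
Proof.
move=> x E mE; rewrite !nuE -(tm (a x) (measurable_aut_image a mE)).
congr (m _).
apply/seteqP; split=> [_ [_ [y Ey <-] <-]|_ [_ [y Ey <-] <-]].
  by exists (a y); [exists y|rewrite autD].
by exists (x + y); [exists y|rewrite autD].
Qed.

Let snu : sigma_finite setT nu.
Proof.
have [F FT mF] := sm; exists (fun n => ainv @` F n).
  apply/seteqP; split=> // x _.
  have : [set: borel G] (a x) by [].
  by rewrite FT => -[n _ Fn]; exists n => //; exists (a x) => //; exact: autK.
move=> n; split; first exact: (measurable_aut_image (aut_sym a) (mF n).1).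
rewrite nuE (_ : a @` _ = F n); first exact: (mF n).2.
apply/seteqP; split=> [_ [_ [x Fx <-] <-]|x Fx]; first by rewrite aut_invK.
by exists (ainv x); [exists x|exact: aut_invK].
Qed.

(** The image of an invariant measure under an automorphism is invariant again,
    hence proportional to it. *)
Lemma automorphism_scaling (B : set (borel G)) :
  measurable B -> m B != 0%E -> (m B < +oo)%E ->
  exists2 c : R, 0 < c &
    forall E : set (borel G), measurable E -> m (a @` E) = (c%:E * m E)%E.
Proof.
move=> mB B0 Boo.
pose k := nu ((fun x : G => - x) @` B).
have H (E : set (borel G)) : measurable E -> (m B * m (a @` E) = m E * k)%E.
  by move=> mE; rewrite -nuE; exact: invariant_measures_proportional.
(* The constant [k / m B] is positive and finite: the set [a^-1 B], whose image
   has the finite measure of [B], excludes both degenerate cases. *)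
have mV : measurable (aut_inv a @` B : set (borel G)).
  exact: (measurable_aut_image (aut_sym a) mB).
have aV : a @` (aut_inv a @` B) = B.
  apply/seteqP; split=> [_ [_ [x Bx <-] <-]|x Bx]; first by rewrite aut_invK.
  by exists (aut_inv a x); [exists x|exact: aut_invK].
have k0 : (0 <= k)%E by exact: measure_ge0.
have mV0 : m (aut_inv a @` B) != 0%E.
  apply: contraNneq B0 => mV0.
  by have /eqP := H _ mV; rewrite aV mV0 mul0e mule_eq0 orbb.
have koo : (k < +oo)%E.
  rewrite ltey; apply: contra_neq mV0 => koo; apply/eqP.
  apply: contraT => mV0; have := H _ mV; rewrite aV koo gt0_muley.
    by move=> /eqP; rewrite lt_eqF // lte_mul_pinfty // ge0_fin_numE.
  by rewrite lt0e mV0 measure_ge0.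
have k1 : k != 0%E.
  apply: contraNneq B0 => k1.
  by have /eqP := H _ mV; rewrite aV k1 mule0 mule_eq0 orbb.
have mBf : m B \is a fin_num by rewrite ge0_fin_numE.
have kf : k \is a fin_num by rewrite ge0_fin_numE.
exists (fine k / fine (m B)).
  by rewrite divr_gt0 // fine_gt0 // lt0e ?k1 ?B0 ?k0 ?koo //= measure_ge0.
move=> E mE; have := H E mE.
rewrite -(fineK kf) -{1}(fineK mBf) muleC => HE.
rewrite EFinM -(muleC (m E)) muleA -HE -muleA -EFinM divff ?mule1 //.
by rewrite fine_eq0.
Qed.
End automorphism_scaling.

(** * The squared L2 seminorm of complex functions *)

Section complex_facts.
Variable R : realType.
Implicit Types z w : R[i].

Lemma normc2E z : normc z ^+ 2 = complex.Re z ^+ 2 + complex.Im z ^+ 2.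
Proof. by case: z => a b /=; rewrite sqr_sqrtr // addr_ge0 ?sqr_ge0. Qed.

Lemma creM z w : complex.Re (z * w) =
  complex.Re z * complex.Re w - complex.Im z * complex.Im w.
Proof. by case: z w => [a b] [c d]. Qed.

Lemma cimM z w : complex.Im (z * w) =
  complex.Re z * complex.Im w + complex.Im z * complex.Re w.
Proof. by case: z w => [a b] [c d]. Qed.

Lemma creD z w : complex.Re (z + w) = complex.Re z + complex.Re w.
Proof. by case: z w => [a b] [c d]. Qed.

Lemma cimD z w : complex.Im (z + w) = complex.Im z + complex.Im w.
Proof. by case: z w => [a b] [c d]. Qed.

Lemma creN z : complex.Re (- z) = - complex.Re z.
Proof. by case: z. Qed.

Lemma cimN z : complex.Im (- z) = - complex.Im z.
Proof. by case: z. Qed.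

Lemma normc_nneg z : 0 <= normc z.
Proof. by case: z => a b; exact: sqrtr_ge0. Qed.

Lemma normc2_ge0 z : 0 <= normc z ^+ 2.
Proof. exact: sqr_ge0. Qed.

Lemma normc2M z w : normc (z * w) ^+ 2 = normc z ^+ 2 * normc w ^+ 2.
Proof. by rewrite normcM exprMn. Qed.

Lemma normc2D_le z w :
  normc (z + w) ^+ 2 <= 2 * normc z ^+ 2 + 2 * normc w ^+ 2.
Proof.
rewrite !normc2E creD cimD -subr_ge0.
set a := complex.Re z; set b := complex.Im z.
set c := complex.Re w; set e := complex.Im w.
rewrite (_ : _ - _ = (a - c) ^+ 2 + (b - e) ^+ 2); last by ring.
by rewrite addr_ge0 ?sqr_ge0.
Qed.

Lemma normc2_conj z : normc z^*%C ^+ 2 = normc z ^+ 2.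
Proof. by rewrite !normc2E; case: z => a b /=; rewrite sqrrN. Qed.

Lemma normc2_eq0 z : (normc z ^+ 2 == 0) = (z == 0).
Proof.
rewrite sqrf_eq0; apply/idP/idP => [/eqP/eq0_normc ->//|/eqP ->].
by rewrite normc0.
Qed.

Lemma normc_real (x : R) : normc x%:C%C ^+ 2 = x ^+ 2.
Proof. by rewrite normc2E /= expr0n addr0. Qed.

Lemma norm1_normc2 z : `|z| = 1 -> normc z ^+ 2 = 1.
Proof.
move=> z1; rewrite normc2E; apply: complexI.
by rewrite /= add_Re2_Im2 z1 expr1n.
Qed.
End complex_facts.

Section ae.
Context d (T : measurableType d) (R : realType).
Variables (mu : {measure set T -> \bar R}).

Lemma ae_mono (P Q : T -> Prop) : (forall x, P x -> Q x) ->
  {ae mu, forall x, P x} -> {ae mu, forall x, Q x}.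
Proof. exact: filterS. Qed.

Lemma ae_mono2 (P Q S : T -> Prop) : (forall x, P x -> Q x -> S x) ->
  {ae mu, forall x, P x} -> {ae mu, forall x, Q x} -> {ae mu, forall x, S x}.
Proof. exact: filterS2. Qed.

Lemma ae_seq (I : eqType) (s : seq I) (P : I -> T -> Prop) :
  (forall i, {ae mu, forall x, P i x}) ->
  {ae mu, forall x, forall i, i \in s -> P i x}.
Proof.
move=> aeP; elim: s => [|j s IH]; first exact: aeW.
apply: ae_mono2 (aeP j) IH => x Pj Ps i.
by rewrite inE => /orP[/eqP ->|/Ps].
Qed.

End ae.

Section L2_theory.
Context d (T : measurableType d) (R : realType).
Variables (mu : {measure set T -> \bar R}).
Implicit Types (f g : T -> R[i]) (D : set T).

Lemma cmeasurable_cst D (c : R[i]) : cmeasurable D (fun=> c).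
Proof. by split; exact: measurable_cst. Qed.

Lemma cmeasurableD D f g : cmeasurable D f -> cmeasurable D g ->
  cmeasurable D (fun x => f x + g x).
Proof.
move=> [fr fi] [gr gi]; split.
  by under eq_fun do rewrite creD; exact: measurable_funD.
by under eq_fun do rewrite cimD; exact: measurable_funD.
Qed.

Lemma cmeasurableM D f g : cmeasurable D f -> cmeasurable D g ->
  cmeasurable D (fun x => f x * g x).
Proof.
move=> [fr fi] [gr gi]; split.
  under eq_fun do rewrite creM.
  by apply: measurable_funB; exact: measurable_funM.
under eq_fun do rewrite cimM.
by apply: measurable_funD; exact: measurable_funM.
Qed.

Lemma cmeasurable_conj D f : cmeasurable D f ->
  cmeasurable D (fun x => (f x)^*%C).
Proof.
move=> [fr fi]; split.
  rewrite (_ : (fun _ => _) = (fun x => complex.Re (f x))) //.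
  by apply/funext => x; case: (f x).
rewrite (_ : (fun _ => _) = (fun x => - complex.Im (f x))).
  exact: measurable_funN.
by apply/funext => x; case: (f x).
Qed.

Lemma cmeasurable_indic D (E : set T) : measurable E ->
  cmeasurable D (fun x => \1_E x : R[i]).
Proof.
move=> mE; split.
  rewrite (_ : (fun _ => _) = \1_E); first exact: measurable_indic.
  by apply/funext => x; rewrite !indicE; case: (x \in E).
rewrite (_ : (fun _ => _) = cst 0); first exact: measurable_cst.
by apply/funext => x; rewrite indicE; case: (x \in E).
Qed.

Lemma cmeasurable_sum D (I : Type) (s : seq I) (h : I -> T -> R[i]) :
  (forall i, cmeasurable D (h i)) -> cmeasurable D (\sum_(i <- s) h i).
Proof.
move=> mh; elim/big_rec: _ => [|i f _ mf]; first exact: cmeasurable_cst.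
exact: cmeasurableD.
Qed.

Lemma cmeasurableS (E D : set T) f : measurable E -> D `<=` E ->
  cmeasurable E f -> cmeasurable D f.
Proof.
by move=> mE DE [fr fi]; split;
  [exact: measurable_funS fr|exact: measurable_funS fi].
Qed.

Lemma measurable_normc2 D f : cmeasurable D f ->
  measurable_fun D (fun x => (normc (f x) ^+ 2)%:E).
Proof.
move=> [fr fi]; apply/measurable_EFinP; under eq_fun do rewrite normc2E.
by apply: measurable_funD; exact: measurable_funX.
Qed.

Lemma cmeasurable_normc D (f : T -> R[i]) : cmeasurable D f ->
  measurable_fun D (fun x => normc (f x)).
Proof.
move=> mf.
have m2 : measurable_fun D (fun x => normc (f x) ^+ 2).
  apply/measurable_EFinP; exact: measurable_normc2.
rewrite (_ : (fun _ => _) = @Num.sqrt R \o (fun x => normc (f x) ^+ 2)).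
  apply: measurableT_comp m2; apply: continuous_measurable_fun.
  exact: sqrt_continuous.
by apply/funext => x /=; rewrite sqrtr_sqr ger0_norm // normc_nneg.
Qed.

Lemma cmeasurableB D (f g : T -> R[i]) : cmeasurable D f -> cmeasurable D g ->
  cmeasurable D (f - g).
Proof.
move=> mf mg; apply: cmeasurableD => //.
case: mg => [gr gi]; split.
  by under eq_fun do rewrite creN; exact: measurable_funN.
by under eq_fun do rewrite cimN; exact: measurable_funN.
Qed.

(** The squared seminorm, with values in the extended reals so that no
    finiteness has to be known before computing with it. *)
Definition nsq D f : \bar R := (\int[mu]_(x in D) (normc (f x) ^+ 2)%:E)%E.

Lemma nsq_ge0 D f : (0 <= nsq D f)%E.
Proof. by apply: integral_ge0 => x _; rewrite lee_fin normc2_ge0. Qed.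

Lemma l2norm_sqr D f : l2norm mu D f ^+ 2 = fine (nsq D f).
Proof.
rewrite /l2norm sqr_sqrtr //; apply: fine_ge0; exact: nsq_ge0.
Qed.

(** The parallelogram bound stands in for the triangle inequality: the factors
    [2] are harmless because the estimate only serves to let errors tend to
    zero. *)
Lemma nsqD D f g : measurable D -> cmeasurable D f -> cmeasurable D g ->
  (nsq D (f + g)%R <= 2%:E * nsq D f + 2%:E * nsq D g)%E.
Proof.
move=> mD mf mg.
have n0 (h : T -> R[i]) x : D x -> (0 <= (normc (h x) ^+ 2)%:E)%E.
  by move=> _; rewrite lee_fin normc2_ge0.
have n2 (h : T -> R[i]) x : D x -> (0 <= 2%:E * (normc (h x) ^+ 2)%:E)%E.
  by move=> Dx; rewrite mule_ge0 // n0.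
have m2f := measurable_normc2 mf; have m2g := measurable_normc2 mg.
rewrite /nsq -!ge0_integralZl //; do ?exact: n0.
rewrite -ge0_integralD //; do ?[exact: n2|exact: measurable_funeM].
apply: ge0_le_integral => //.
- exact: n0.
- by apply: measurable_normc2; exact: cmeasurableD.
- by apply: emeasurable_funD; apply: measurable_funeM; exact: measurable_normc2.
by move=> x _; rewrite -!EFinM -EFinD lee_fin normc2D_le.
Qed.

Lemma nsqZ D (c : R[i]) f : measurable D -> cmeasurable D f ->
  nsq D (c *: f) = ((normc c ^+ 2)%:E * nsq D f)%E.
Proof.
move=> mD mf; have m2f := measurable_normc2 mf.
rewrite /nsq -ge0_integralZl ?lee_fin ?normc2_ge0 //.
  by apply: eq_integral => x _; rewrite -EFinM -normc2M.
by move=> x _; rewrite lee_fin normc2_ge0.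
Qed.

Lemma nsqN D f : nsq D (- f) = nsq D f.
Proof.
by apply: eq_integral => x _; rewrite !normc2E /= creN cimN !sqrrN.
Qed.

Lemma nsq_ae D f g : measurable D -> cmeasurable D f -> cmeasurable D g ->
  {ae mu, forall x, D x -> f x = g x} -> nsq D f = nsq D g.
Proof.
move=> mD mf mg fg; apply: ae_eq_integral => //; try exact: measurable_normc2.
by apply: filterS fg => x /[apply] ->.
Qed.

Lemma nsq_eq0 D f : measurable D -> cmeasurable D f -> nsq D f = 0%E ->
  {ae mu, forall x, D x -> f x = 0}.
Proof.
move=> mD mf f0.
have := (@ae_eq_integral_abs _ _ _ mu D mD _ (measurable_normc2 mf)).1.
under eq_integral do rewrite gee0_abs ?lee_fin ?normc2_ge0 //.
move=> /(_ f0); apply: filterS => x H Dx; apply/eqP.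
by have /= [/eqP] := H Dx; rewrite normc2_eq0.
Qed.

End L2_theory.
Arguments nsq {d T R} mu D f%_ring_scope.

Section L2_space.
Context d (T : measurableType d) (R : realType).
Variables (mu : {measure set T -> \bar R}).
Implicit Types (f g : T -> R[i]) (D : set T).

Lemma L2D D f g : measurable D ->
  L2 mu D f -> L2 mu D g -> L2 mu D (f + g).
Proof.
move=> mD [mf ff] [mg gg]; split; first exact: cmeasurableD.
apply: le_lt_trans (nsqD _ mD mf mg) _.
by apply: lte_add_pinfty; rewrite lte_mul_pinfty.
Qed.

Lemma cmeasurableZ D (c : R[i]) f :
  cmeasurable D f -> cmeasurable D (c *: f).
Proof. by move=> mf; apply: cmeasurableM => //; exact: cmeasurable_cst. Qed.

Lemma L2Z D (c : R[i]) f : measurable D ->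
  L2 mu D f -> L2 mu D (c *: f).
Proof.
move=> mD [mf ff]; split; first exact: cmeasurableZ.
have := nsqZ mu c mD mf; rewrite /nsq => ->.
by rewrite lte_mul_pinfty // lee_fin normc2_ge0.
Qed.

Lemma L2_0 D :
  L2 mu D 0.
Proof.
split; first exact: cmeasurable_cst.
by under eq_integral do rewrite normc0 expr0n; rewrite integral0.
Qed.

Lemma L2B D f g : measurable D ->
  L2 mu D f -> L2 mu D g -> L2 mu D (f - g).
Proof.
by move=> mD Lf Lg; rewrite -scaleN1r; apply: L2D => //; exact: L2Z.
Qed.

Lemma L2_sum D (I : eqType) (s : seq I) (h : I -> T -> R[i]) : measurable D ->
  (forall i, i \in s -> L2 mu D (h i)) -> L2 mu D (\sum_(i <- s) h i).
Proof.
move=> mD Lh; rewrite big_seq.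
by apply: (big_ind (L2 mu D)) => //; [exact: L2_0|move=> f g; exact: L2D].
Qed.

Lemma L2_nsq_fin D f : L2 mu D f -> nsq mu D f \is a fin_num.
Proof. by move=> [_ ff]; rewrite ge0_fin_numE // nsq_ge0. Qed.

Lemma Re_l2dot D f : complex.Re (l2dot mu D f f) = fine (nsq mu D f).
Proof.
rewrite /= /Rintegral /nsq; congr fine; apply: eq_integral => x _; congr EFin.
by rewrite creM normc2E; case: (f x) => a b /=; rewrite mulrN opprK -!expr2.
Qed.

Lemma L1Z (c : R[i]) f : L1 mu setT f -> L1 mu setT (fun x => c * f x).
Proof.
move=> [mf ff]; split.
  by apply: cmeasurableM => //; exact: cmeasurable_cst.
under eq_integral do rewrite normcM EFinM.
rewrite ge0_integralZl ?lee_fin ?normc_nneg //.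
- by rewrite lte_mul_pinfty // lee_fin normc_nneg.
- by apply/measurable_EFinP; exact: cmeasurable_normc.
- by move=> x _; rewrite lee_fin normc_nneg.
Qed.

End L2_space.

(** * Maps that scale a measure *)

Section change_of_variables.
Context d (T : measurableType d) (R : realType).
Variables (mu : {measure set T -> \bar R}) (theta : T -> T) (k : R).
Hypotheses (mt : measurable_fun setT theta) (k0 : 0 < k).
Hypothesis tk : forall E, measurable E ->
  mu (theta @^-1` E) = (k%:E * mu E)%E.

Let mpre E : measurable E -> measurable (theta @^-1` E).
Proof. by move=> mE; rewrite -[X in measurable X]setTI; exact: mt. Qed.

(** On measurable sets the image of [mu] under [theta] is [k] times [mu]. *)
Lemma ge0_integral_comp (D : set T) (g : T -> \bar R) : measurable D ->
  measurable_fun D g -> (forall x, D x -> 0 <= g x)%E ->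
  (\int[mu]_(x in theta @^-1` D) g (theta x) = k%:E * \int[mu]_(x in D) g x)%E.
Proof.
move=> mD mg g0.
have k0' : 0 <= k := ltW k0.
transitivity (\int[mscale (NngNum k0') mu]_(x in D) g x)%E; last first.
  by rewrite ge0_integral_mscale.
rewrite -(@ge0_integral_pushforward _ _ _ _ _ _ mt mu D g) //; last first.
  by move=> x; rewrite inE; exact: g0.
apply: eq_measure_integral => E mE _.
exact: tk.
Qed.

Lemma ae_comp (P : T -> Prop) :
  {ae mu, forall x, P x} -> {ae mu, forall x, P (theta x)}.
Proof.
move=> [N [mN N0 PN]]; exists (theta @^-1` N); split; first exact: mpre.
  by rewrite tk // N0 mule0.
by move=> x; exact: PN.
Qed.

Lemma cmeasurable_comp (D : set T) (f : T -> R[i]) : measurable D ->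
  cmeasurable D f -> cmeasurable (theta @^-1` D) (fun x => f (theta x)).
Proof.
move=> mD [fr fi].
have h (g : T -> R) : measurable_fun D g ->
    measurable_fun (theta @^-1` D) (fun x => g (theta x)).
  move=> mg; apply: (measurable_comp mD) => //.
    by move=> _ [x Dx <-].
  exact: measurable_funTS.
by split; [exact: (h _ fr)|exact: (h _ fi)].
Qed.

Lemma nsq_comp (D : set T) (f : T -> R[i]) : measurable D -> cmeasurable D f ->
  nsq mu (theta @^-1` D) (fun x => f (theta x)) = (k%:E * nsq mu D f)%E.
Proof.
move=> mD mf.
rewrite /nsq (@ge0_integral_comp D (fun x => (normc (f x) ^+ 2)%:E)) //.
  exact: measurable_normc2.
by move=> x _; rewrite lee_fin normc2_ge0.
Qed.

Lemma Rintegral_comp (g : T -> R) : mu.-integrable setT (EFin \o g) ->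
  \int[mu]_x g (theta x) = k * \int[mu]_x g x.
Proof.
move=> ig; rewrite /Rintegral integralE [X in _ = _ * fine X]integralE.
have /measurable_int mg := ig.
have := @ge0_integral_comp setT _ measurableT (measurable_funepos mg)
  (fun x _ => funepos_ge0 _ x).
have := @ge0_integral_comp setT _ measurableT (measurable_funeneg mg)
  (fun x _ => funeneg_ge0 _ x).
rewrite preimage_setT => HN HP.
have -> : (\int[mu]_x (fun x => (g (theta x))%:E)^\+ x =
    \int[mu]_x (EFin \o g)^\+ (theta x))%E.
  by apply: eq_integral => x _; rewrite !funeposE.
have -> : (\int[mu]_x (fun x => (g (theta x))%:E)^\- x =
    \int[mu]_x (EFin \o g)^\- (theta x))%E.
  by apply: eq_integral => x _; rewrite !funenegE.
rewrite HN HP.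
have fp := integral_fune_fin_num measurableT
  (integrable_funepos measurableT ig).
have fn := integral_fune_fin_num measurableT
  (integrable_funeneg measurableT ig).
rewrite -(fineK fp) -(fineK fn).
by rewrite -!EFinM -!EFinB /= mulrBr.
Qed.

Lemma L1_integrable (f : T -> R[i]) : L1 mu setT f ->
  mu.-integrable setT (EFin \o (@complex.Re R \o f)) /\
  mu.-integrable setT (EFin \o (@complex.Im R \o f)).
Proof.
move=> [[fr fi] foo].
have mn : measurable_fun setT (fun x => (normc (f x))%:E).
  by apply/measurable_EFinP; exact: cmeasurable_normc.
have bound (p : R[i] -> R) : (forall z, p z ^+ 2 <= normc z ^+ 2) ->
    measurable_fun setT (fun x => p (f x)) ->
    mu.-integrable setT (EFin \o (p \o f)).
  move=> pb mp; apply/integrableP; split; first exact/measurable_EFinP.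
  apply: le_lt_trans foo; apply: ge0_le_integral => //.
  - by apply: measurableT_comp => //; exact/measurable_EFinP.
  - move=> x _; rewrite lee_fin.
    rewrite /= -(ger0_norm (normc_nneg (f x))) -ler_sqr ?nnegrE //.
    by rewrite !real_normK ?num_real.
by split; apply: bound => // z; rewrite normc2E ?lerDl ?lerDr sqr_ge0.
Qed.

Lemma cintegral_comp (f : T -> R[i]) : L1 mu setT f ->
  cintegral mu setT (fun x => f (theta x)) = k%:C%C * cintegral mu setT f.
Proof.
move=> /L1_integrable[ir ii]; rewrite /cintegral.
rewrite (Rintegral_comp ir) (Rintegral_comp ii).
by apply/eqP; rewrite eq_complex /= !mul0r subr0 addr0 !eqxx.
Qed.

Lemma cintegralZ (c : R[i]) (f : T -> R[i]) : L1 mu setT f ->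
  cintegral mu setT (fun x => c * f x) = c * cintegral mu setT f.
Proof.
move=> /L1_integrable[ir ii]; rewrite /cintegral.
have iZ (r : R) (g : T -> R) : mu.-integrable setT (EFin \o g) ->
    mu.-integrable setT (EFin \o (fun x => r * g x)).
  move=> ig; rewrite (_ : EFin \o _ = fun x => (r%:E * (EFin \o g) x)%E) //.
  exact: integrableZl.
apply/eqP; rewrite eq_complex !creM !cimM /=; apply/andP; split; apply/eqP.
  under eq_Rintegral do rewrite creM.
  rewrite RintegralB ?RintegralZl //; exact: iZ.
under eq_Rintegral do rewrite cimM.
rewrite RintegralD ?RintegralZl //; exact: iZ.
Qed.

End change_of_variables.

(** * Approximation in L2 *)

Section L2_approx.
Context d (T : measurableType d) (R : realType).
Variables (mu : {measure set T -> \bar R}).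

Definition restr (A : set T) (f : T -> R[i]) : T -> R[i] :=
  fun x => \1_A x * f x.

Lemma restr_in A f x : A x -> restr A f x = f x.
Proof. by move=> Ax; rewrite /restr indicE mem_set // mul1r. Qed.

Lemma restr_out A f x : ~ A x -> restr A f x = 0.
Proof. by move=> Ax; rewrite /restr indicE memNset // mul0r. Qed.

Lemma cmeasurable_restr D A f : measurable A -> cmeasurable D f ->
  cmeasurable D (restr A f).
Proof.
by move=> mA mf; apply: cmeasurableM => //; exact: cmeasurable_indic.
Qed.

(** Dominated convergence, with the squared modulus of [f] as the dominating
    function. *)
Lemma L2_exhaustion (f : T -> R[i]) (A : nat -> set T) :
  (forall n, measurable (A n)) -> L2 mu setT f ->
  {ae mu, forall x, exists N, forall n, (N <= n)%N -> A n x \/ f x = 0} ->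
  forall e : R, 0 < e -> exists n, (nsq mu setT (f - restr (A n) f) < e%:E)%E.
Proof.
move=> mA [mf foo] fA e e0.
pose h n (x : T) := (normc ((f - restr (A n) f) x) ^+ 2)%:E : \bar R.
have mg n : cmeasurable setT (f - restr (A n) f).
  by apply: cmeasurableB => //; exact: cmeasurable_restr.
have mh n : measurable_fun setT (h n) by exact: measurable_normc2.
have ig : mu.-integrable setT (fun x => (normc (f x) ^+ 2)%:E).
  apply/integrableP; split; first exact: measurable_normc2.
  by under eq_integral do rewrite gee0_abs ?lee_fin ?normc2_ge0 //.
have m0 : measurable_fun setT (cst 0%E : T -> \bar R) by exact: measurable_cst.
have hle : {ae mu, forall x (n : nat), setT x ->
    (`|h n x| <= (normc (f x) ^+ 2)%:E)%E}.
  apply: aeW => x n _; rewrite gee0_abs ?lee_fin ?normc2_ge0 //.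
  rewrite [(_ - _) x](_ : _ = f x - restr (A n) f x) //.
  have [Anx|Anx] := pselect (A n x).
    by rewrite restr_in // subrr normc0 expr0n normc2_ge0.
  by rewrite restr_out // subr0.
have hcvg : {ae mu, forall x, setT x -> h ^~ x @ \oo --> cst 0%E x}.
  apply: filterS fA => x [N HN] _; apply: cvg_near_cst.
  exists N => // n /= Nn.
  rewrite /h [(_ - _) x](_ : _ = f x - restr (A n) f x) //.
  have [Anx|fx] := HN n Nn; first by rewrite restr_in // subrr normc0 expr0n.
  by rewrite /restr fx mulr0 subrr normc0 expr0n.
have [_ _ /=] := dominated_convergence measurableT mh m0 hcvg ig hle.
rewrite integral0 => /fine_cvgP[[N1 _ fin1]] /cvgr0Pnorm_lt /(_ _ e0)[N2 _ lt2].
pose N := maxn N1 N2; exists N.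
have := fin1 N (leq_maxl _ _); have := lt2 N (leq_maxr _ _); rewrite /=.
move=> ltN finN; rewrite /nsq -[X in (X < _)%E](fineK finN) lte_fin.
by apply: le_lt_trans ltN; rewrite ler_norm.
Qed.

(** Discard the points where [|f| < 1/(n+1)]: elsewhere [|f| <= (n+1) |f|^2] is
    integrable, and at every point the cut-off is eventually harmless. *)
Lemma L1L2_dense (f : T -> R[i]) (e : R) : L2 mu setT f -> 0 < e ->
  exists g, [/\ L1 mu setT g, L2 mu setT g & (nsq mu setT (f - g) < e%:E)%E].
Proof.
move=> Lf e0; have [mf foo] := Lf.
pose A n := [set x | n.+1%:R^-1 <= normc (f x)].
have mA n : measurable (A n).
  rewrite -[X in measurable X]setTI.
  have := cmeasurable_normc mf measurableT (measurable_itv `[n.+1%:R^-1, +oo[).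
  congr measurable; apply/seteqP.
  by split=> x /=; rewrite in_itv /= andbT.
have [|n fn] := L2_exhaustion mA Lf _ e0.
  apply: aeW => x.
  have [/eqP fx|fx] := boolP (f x == 0); first by exists 0%N => n _; right.
  have nf : 0 < normc (f x).
    by rewrite lt0r normc_nneg andbT; apply: contra fx => /eqP/eq0_normc ->.
  have [k kf] := ltr_add_invr nf; exists k => m km; left.
  rewrite /A /= (le_trans _ (ltW kf)) // add0r lef_pV2 ?posrE // ler_nat //.
have mg : cmeasurable setT (restr (A n) f) by exact: cmeasurable_restr.
exists (restr (A n) f); split => //.
- split => //.
  apply: (@le_lt_trans _ _ (\int[mu]_x (n.+1%:R%:E * (normc (f x) ^+ 2)%:E))%E).
    apply: ge0_le_integral => //.
    + by move=> x _; rewrite lee_fin normc_nneg.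
    + by apply/measurable_EFinP; exact: cmeasurable_normc.
    + by apply: measurable_funeM; exact: measurable_normc2.
    move=> x _; rewrite -EFinM lee_fin.
    have [Anx|Anx] := pselect (A n x).
      have n0 : 0 < normc (f x) by apply: lt_le_trans Anx; rewrite invr_gt0.
      rewrite restr_in //.
      rewrite expr2 mulrA; apply: ler_peMl; first exact: ltW.
      by rewrite -ler_pdivrMl // mulr1.
    by rewrite restr_out // normc0 mulr_ge0 ?normc2_ge0.
  rewrite ge0_integralZl //.
  + by rewrite lte_mul_pinfty // lee_fin.
  + exact: measurable_normc2.
  + by move=> x _; rewrite lee_fin normc2_ge0.
- split => //; apply: le_lt_trans foo; apply: ge0_le_integral => //.
  + by move=> x _; rewrite lee_fin normc2_ge0.
  + exact: measurable_normc2.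
  + exact: measurable_normc2.
  move=> x _; rewrite lee_fin.
  have [Anx|Anx] := pselect (A n x); first by rewrite restr_in.
  by rewrite restr_out // normc0 expr0n normc2_ge0.
Qed.

End L2_approx.

Section L2_pieces.
Context d (T : measurableType d) (R : realType).
Variables (mu : {measure set T -> \bar R}).

Lemma nsq_restr (A : set T) (f : T -> R[i]) : measurable A ->
  nsq mu setT (restr A f) = nsq mu A f.
Proof.
move=> mA; rewrite /nsq [RHS]integral_mkcond; apply: eq_integral => x _.
rewrite patchE; case: ifPn => [|].
  by rewrite inE => Ax; rewrite restr_in.
by rewrite notin_setE => Ax; rewrite restr_out // normc0 expr0n.
Qed.

(** Almost everywhere at most one of the functions is nonzero, so the squared
    modulus of the sum is the sum of the squared moduli. *)
Lemma nsq_sum_disjoint (K : choiceType) (S : {fset K}) (tile : K -> set T)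
    (u : K -> T -> R[i]) :
  (forall s, s \in S -> cmeasurable setT (u s)) ->
  (forall s x, ~ tile s x -> u s x = 0) ->
  {ae mu, forall x, forall s s', s \in S -> s' \in S ->
     tile s x -> tile s' x -> s = s'} ->
  nsq mu setT (\sum_(s <- S) u s) = (\sum_(s <- S) nsq mu setT (u s))%E.
Proof.
move=> mu_ u0 disj.
pose w s (x : T) : \bar R := if s \in S then (normc (u s x) ^+ 2)%:E else 0%E.
have mw s : measurable_fun setT (w s).
  rewrite /w; case: (boolP (s \in S)) => sS; last exact: measurable_cst.
  by apply: measurable_normc2; exact: mu_.
have wE : (\sum_(s <- S) nsq mu setT (u s) = \sum_(s <- S) \int[mu]_x w s x)%E.
  by apply: eq_big_seq => s sS; rewrite /nsq /w sS.
rewrite wE -ge0_integral_sum //; last first.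
  by move=> s x _; rewrite /w; case: ifP => // _; rewrite lee_fin normc2_ge0.
apply: ae_eq_integral => //.
- apply: measurable_normc2; rewrite big_seq.
  apply: (big_ind (cmeasurable setT)).
  + exact: cmeasurable_cst.
  + by move=> f g; exact: cmeasurableD.
  + exact: mu_.
- exact: emeasurable_sum.
apply: ae_mono disj => x dx _; rewrite fct_sumE.
have [[s sS sx]|nos] := pselect (exists2 s, s \in S & tile s x); last first.
  rewrite big_seq big1 => [|s sS]; last first.
    by apply: u0 => sx; apply: nos; exists s.
  rewrite normc0 expr0n /= big_seq big1 // => s sS.
  rewrite /w sS u0 ?normc0 ?expr0n //.
  by move=> sx; apply: nos; exists s.
have u0' s' : s' \in S -> s' != s -> u s' x = 0.
  move=> s'S s's; apply: u0 => s'x; move/eqP: s's; apply; exact: dx.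
rewrite (big_fsetD1 s) //= big_seq big1 ?addr0; last first.
  by move=> s'; rewrite !inE => /andP[s's s'S]; exact: u0'.
rewrite (big_fsetD1 s) //= big_seq big1 ?adde0; first by rewrite /w sS.
move=> s'; rewrite !inE => /andP[s's s'S].
by rewrite /w s'S u0' // normc0 expr0n.
Qed.

Section approximable.
Variables (I : choiceType) (D : set I) (x : I -> T -> R[i]).
Hypothesis xL2 : forall i, D i -> L2 mu setT (x i).

(** Membership in the closed linear span of the [x i]. Unlike density of the
    whole span, it can be established function by function: it is stable under
    sums, limits and equality almost everywhere. *)
Definition approximable (h : T -> R[i]) := forall e : R, 0 < e ->
  exists (J : {fset I}) (c : I -> R[i]), [set` J] `<=` D /\
    (nsq mu setT (h - \sum_(i <- J) c i *: x i) < e%:E)%E.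

Lemma L2_comb (J : {fset I}) (c : I -> R[i]) : [set` J] `<=` D ->
  L2 mu setT (\sum_(i <- J) c i *: x i).
Proof.
by move=> JD; apply: L2_sum => // i iJ; apply: L2Z => //; apply: xL2; exact: JD.
Qed.

Lemma approximable0 : approximable 0.
Proof.
move=> e e0; exists fset0, (fun=> 0); split => //.
rewrite big_seq_fset0 subr0 /nsq.
by under eq_integral do rewrite normc0 expr0n; rewrite integral0 lte_fin.
Qed.

Lemma nsqD_lt (f g : T -> R[i]) (e : R) : L2 mu setT f -> L2 mu setT g ->
  (nsq mu setT f < (e / 4)%:E)%E -> (nsq mu setT g < (e / 4)%:E)%E ->
  (nsq mu setT (f + g) < e%:E)%E.
Proof.
move=> Lf Lg fe ge.
apply: le_lt_trans (nsqD _ measurableT Lf.1 Lg.1) _.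
move: fe ge; rewrite -(fineK (L2_nsq_fin Lf)) -(fineK (L2_nsq_fin Lg)).
rewrite !lte_fin => fe ge.
lra.
Qed.

Lemma approximableD f g : L2 mu setT f -> L2 mu setT g ->
  approximable f -> approximable g -> approximable (f + g).
Proof.
move=> Lf Lg af ag e e0; have e4 : 0 < e / 4 by rewrite divr_gt0.
have [J1 [c1 [D1 H1]]] := af _ e4; have [J2 [c2 [D2 H2]]] := ag _ e4.
pose c i : R[i] :=
  (if i \in J1 then c1 i else 0) + (if i \in J2 then c2 i else 0).
exists (J1 `|` J2)%fset, c; split.
  by move=> i /=; rewrite inE => /orP[/D1|/D2].
have -> : \sum_(i <- (J1 `|` J2)%fset) c i *: x i =
    \sum_(i <- J1) c1 i *: x i + \sum_(i <- J2) c2 i *: x i.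
  under eq_bigr do rewrite scalerDl.
  rewrite big_split /=; congr (_ + _).
    rewrite -(@big_fset_incl _ _ _ _ J1 (J1 `|` J2)%fset) ?fsubsetUl //.
      by apply: eq_big_seq => i ->.
    by move=> i _ /negbTE ->; rewrite scale0r.
  rewrite -(@big_fset_incl _ _ _ _ J2 (J1 `|` J2)%fset) ?fsubsetUr //.
    by apply: eq_big_seq => i ->.
  by move=> i _ /negbTE ->; rewrite scale0r.
rewrite opprD addrACA; apply: nsqD_lt => //; apply: L2B => //; exact: L2_comb.
Qed.

Lemma approximable_lim f : L2 mu setT f ->
  (forall e : R, 0 < e -> exists g, [/\ L2 mu setT g, approximable g &
     (nsq mu setT (f - g) < e%:E)%E]) -> approximable f.
Proof.
move=> Lf H e e0; have e4 : 0 < e / 4 by rewrite divr_gt0.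
have [g [Lg ag fg]] := H _ e4; have [J [c [DJ gJ]]] := ag _ e4.
exists J, c; split => //.
rewrite -(subrK g f) -addrA; apply: nsqD_lt => //; apply: L2B => //.
exact: L2_comb.
Qed.

Lemma approximable_ae f g : cmeasurable setT f -> cmeasurable setT g ->
  {ae mu, forall x, f x = g x} ->
  approximable f -> approximable g.
Proof.
move=> mf mg fg af e e0; have [J [c [DJ fJ]]] := af e e0.
exists J, c; split => //.
rewrite -(@nsq_ae _ _ _ _ _ (f - \sum_(i <- J) c i *: x i)) //.
- by apply: cmeasurableB => //; exact: (L2_comb c DJ).1.
- by apply: cmeasurableB => //; exact: (L2_comb c DJ).1.
by apply: ae_mono fg => y E _; rewrite !fctE E.
Qed.

Lemma approximable_sum (K : eqType) (S : seq K) (u : K -> T -> R[i]) :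
  (forall s, s \in S -> L2 mu setT (u s) /\ approximable (u s)) ->
  approximable (\sum_(s <- S) u s).
Proof.
move=> H.
suff : L2 mu setT (\sum_(s <- S) u s) /\ approximable (\sum_(s <- S) u s).
  by case.
rewrite big_seq.
apply: (big_ind (fun f => L2 mu setT f /\ approximable f)) => //.
- by split; [exact: L2_0|exact: approximable0].
- by move=> f g [Lf af] [Lg ag]; split; [exact: L2D|exact: approximableD].
Qed.

End approximable.
End L2_pieces.

Lemma nsq_indic d (T : measurableType d) (R : realType)
    (mu : {measure set T -> \bar R}) (E : set T) : measurable E ->
  nsq mu setT (fun x => \1_E x) = mu E.
Proof.
move=> mE; rewrite -[in RHS](setIT E) -integral_indic //.
apply: eq_integral => x _; congr EFin.
by rewrite !indicE; case: (x \in E); rewrite ?normc1 ?normc0 ?expr1n ?expr0n.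
Qed.

Lemma L2_indic d (T : measurableType d) (R : realType)
    (mu : {measure set T -> \bar R}) (E : set T) : measurable E ->
  (mu E < +oo)%E -> L2 mu setT (fun x => \1_E x).
Proof.
move=> mE Eoo; split; first exact: cmeasurable_indic.
by have := nsq_indic mu mE; rewrite /nsq => ->.
Qed.

(** * Continuous complex functions on groups *)

Section continuity_measurability.
Variable R : realType.

Lemma nbhs_complex (z : R[i]) (P : R[i] -> Prop) (r : R) : 0 < r ->
  (forall w, `|z - w| < r%:C%C -> P w) ->
  nbhs (z : R[i]^o) [set w : R[i]^o | P w].
Proof.
move=> r0 H; have oB := ball_open (z : R[i]^o) r%:C%C.
have zB : ball (z : R[i]^o) r%:C%C z by apply: ballxx; rewrite ltcR.
apply: filterS (open_nbhs_nbhs (conj oB zB)) => w.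
by rewrite -ball_normE; exact: H.
Qed.

Lemma open_Re (U : set R) : open U -> open [set z : R[i]^o | U (complex.Re z)].
Proof.
move=> oU; rewrite openE => z Uz.
have /nbhs_ballP[r /= r0 rU] := open_nbhs_nbhs (conj oU Uz).
apply: (nbhs_complex r0) => w zw; apply: rU.
rewrite -ball_normE /=; rewrite -ltcR; apply: le_lt_trans zw.
by have := normc_ge_Re (z - w); rewrite creD creN.
Qed.

Lemma open_Im (U : set R) : open U -> open [set z : R[i]^o | U (complex.Im z)].
Proof.
move=> oU; rewrite openE => z Uz.
have /nbhs_ballP[r /= r0 rU] := open_nbhs_nbhs (conj oU Uz).
apply: (nbhs_complex r0) => w zw; apply: rU.
rewrite -ball_normE /=; rewrite -ltcR; apply: le_lt_trans zw.
rewrite normc_def lecR -cimN -cimD -sqrtr_sqr ler_sqrt; last first.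
  by rewrite addr_ge0 ?sqr_ge0.
by rewrite lerDr sqr_ge0.
Qed.

Lemma continuous_cmeasurable (G : topologicalZmodType) (f : G -> R[i]) :
  continuous (f : G -> R[i]^o) -> cmeasurable [set: borel G] f.
Proof.
move=> /continuousP cf; split.
  apply: (@measurability _ _ (borel G) R setT (fun x => complex.Re (f x)) _
    (RGenOpens.measurableE R)).
  move=> _ [_ [x [y ->]] <-]; rewrite setTI; apply: sub_sigma_algebra.
  exact: (cf _ (open_Re (interval_open _ _))).
apply: (@measurability _ _ (borel G) R setT (fun x => complex.Im (f x)) _
    (RGenOpens.measurableE R)).
move=> _ [_ [x [y ->]] <-]; rewrite setTI; apply: sub_sigma_algebra.
exact: (cf _ (open_Im (interval_open _ _))).
Qed.

Lemma continuous_evaluation (G : topologicalZmodType) (t : G) :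
  continuous (evaluation t : dual_group R G -> R[i]^o).
Proof.
apply/continuousP => U oU; rewrite openE => xi Uxi.
have /nbhs_ballP[r /= r0 rU] := open_nbhs_nbhs (conj oU Uxi).
have := (cvg_dualP xi (nbhs_filter xi)).1 cvg_id [set t] r
  (@compact_set1 _ t) r0.
apply: filterS => eta H; apply: rU; rewrite -ball_normE; exact: H.
Qed.

End continuity_measurability.

(** * The Plancherel transform *)

Section plancherel.
Variables (R : realType) (G : topologicalZmodType).
Local Notation Ghat := (dual_group R G).
Variables (mG : {measure set (borel G) -> \bar R}).
Variables (mGhat : {measure set (borel Ghat) -> \bar R}).
Variable (F : (G -> R[i]) -> (Ghat -> R[i])).
Hypothesis FP : fourier_plancherel mG mGhat F.

Lemma plancherel_nsq f : L2 mG setT f -> nsq mGhat setT (F f) = nsq mG setT f.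
Proof.
move=> Lf; have LFf := plancherel_L2 FP Lf.
have := plancherel_dot FP Lf Lf => /(congr1 (@complex.Re R)).
rewrite !Re_l2dot => E.
by rewrite -(fineK (L2_nsq_fin LFf)) -(fineK (L2_nsq_fin Lf)) E.
Qed.

Lemma F_0 : {ae mGhat, forall xi, F 0 xi = 0}.
Proof.
have := plancherel_linear FP 1 (L2_0 mG setT) (L2_0 mG setT).
apply: ae_mono => xi; rewrite scaler0 addr0 mul1r => /eqP.
by rewrite -subr_eq0 opprD addrA subrr sub0r oppr_eq0 => /eqP.
Qed.

Lemma F_B f g : L2 mG setT f -> L2 mG setT g ->
  {ae mGhat, forall xi, F (f - g) xi = F f xi - F g xi}.
Proof.
move=> Lf Lg; have := plancherel_linear FP (-1) Lg Lf.
by apply: ae_mono => xi; rewrite scaleN1r mulN1r addrC => ->; rewrite addrC.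
Qed.

Lemma F_sum (I : choiceType) (s : seq I) (c : I -> R[i]) (h : I -> G -> R[i]) :
  (forall i, i \in s -> L2 mG setT (h i)) ->
  {ae mGhat, forall xi, F (\sum_(i <- s) c i *: h i) xi =
                        \sum_(i <- s) c i * F (h i) xi}.
Proof.
elim: s => [|i s IH] Lh.
  by move: F_0; apply: ae_mono => xi; rewrite !big_nil.
have Lhs : forall j, j \in s -> L2 mG setT (h j).
  by move=> j js; apply: Lh; rewrite inE js orbT.
have Li : L2 mG setT (h i) by apply: Lh; rewrite inE eqxx.
have Ls : L2 mG setT (\sum_(j <- s) c j *: h j).
  by apply: L2_sum => // j js; apply: L2Z => //; exact: Lhs.
move: (IH Lhs) (plancherel_linear FP (c i) Li Ls); apply: ae_mono2 => xi E1 E2.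
by rewrite !big_cons E2 E1.
Qed.

End plancherel.

(** * Dilations and their adjoints *)

Section intertwining.
Variables (R : realType) (G : topologicalZmodType).
Local Notation Ghat := (dual_group R G).
Variables (mG : {measure set (borel G) -> \bar R}).
Variables (mGhat : {measure set (borel Ghat) -> \bar R}).
Variable (F : (G -> R[i]) -> (Ghat -> R[i])).
Hypothesis FP : fourier_plancherel mG mGhat F.
Hypothesis tG : translation_invariant mG.
Variables (Delta : aut G -> R).
Hypothesis modD : modular_function mG Delta.
Variables (a : aut G) (t : G).

Let D0 : 0 < Delta a. Proof. by have [] := modD a. Qed.

Definition affine : borel G -> borel G := fun x => (a x : G) - t.

Lemma measurable_affine : measurable_fun setT affine.
Proof.
apply: (measurable_continuous (f := fun x : G => a x - t)) => x.
apply: (@continuous_comp _ _ _ a (fun y : G => y - t)); first exact: aut_cont.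
have -> : (fun y : G => y - t) = (fun y => - t + y).
  by apply/funext => y; rewrite addrC.
exact: continuous_addl.
Qed.

Lemma affine_scale (E : set (borel G)) : measurable E ->
  mG (affine @^-1` E) = ((Delta a)^-1%:E * mG E)%E.
Proof.
move=> mE.
have mP : measurable (affine @^-1` E).
  by rewrite -[X in measurable X]setTI; exact: measurable_affine.
have := (modD a).2 _ mP.
rewrite (_ : a @` _ = (fun y : G => t + y) @` E); last first.
  apply/seteqP; split=> [_ [x Ex <-]|_ [y Ey <-]].
    by exists (a x - t) => //; rewrite addrC subrK.
  by exists (aut_inv a (t + y)); rewrite /affine /= aut_invK // addrC addKr.
rewrite tG // => ->.
by rewrite muleA -EFinM mulVf ?mul1e // gt_eqF.
Qed.

Definition dilate (f : G -> R[i]) : G -> R[i] :=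
  fun x => (Num.sqrt (Delta a))%:C%C * f (a x - t).

(** The operator that the Fourier transform puts in place of [dilate]: a
    modulation, then a dilation by the adjoint automorphism. *)
Definition dual_dilate (h : Ghat -> R[i]) : Ghat -> R[i] := fun xi =>
  let eta := aut_inv (adjoint R a) xi in
  (Num.sqrt (Delta a))^-1%:C%C * ((eta t)^*%C * h eta).

Lemma cmeasurable_dilate f : cmeasurable [set: borel G] f ->
  cmeasurable [set: borel G] (dilate f).
Proof.
move=> mf; apply: cmeasurableM; first exact: cmeasurable_cst.
have := cmeasurable_comp measurable_affine measurableT mf.
by rewrite preimage_setT.
Qed.

Lemma nsq_dilate f : cmeasurable [set: borel G] f ->
  nsq mG setT (dilate f) = nsq mG setT f.
Proof.
move=> mf.
have mc : cmeasurable [set: borel G] (fun x => f (a x - t)).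
  have := cmeasurable_comp measurable_affine measurableT mf.
  by rewrite preimage_setT.
have /= := nsqZ mG (Num.sqrt (Delta a))%:C%C measurableT mc.
rewrite (_ : _ *: _ = dilate f) // => ->.
have DV : 0 < (Delta a)^-1 by rewrite invr_gt0.
have /= := nsq_comp measurable_affine DV affine_scale measurableT mf.
rewrite preimage_setT => ->.
by rewrite normc_real sqr_sqrtr ?ltW // muleA -EFinM divff ?mul1e // gt_eqF.
Qed.

Lemma L2_dilate f : L2 mG setT f -> L2 mG setT (dilate f).
Proof.
move=> [mf ff]; split; first exact: cmeasurable_dilate.
by have := nsq_dilate mf; rewrite /nsq => ->.
Qed.

Lemma L1_dilate f : L1 mG setT f -> L1 mG setT (dilate f).
Proof.
move=> [mf ff]; apply: L1Z; split.
  have := cmeasurable_comp measurable_affine measurableT mf.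
  by rewrite preimage_setT.
have DV : 0 < (Delta a)^-1 by rewrite invr_gt0.
have mn : measurable_fun setT (fun x : borel G => (normc (f x))%:E).
  by apply/measurable_EFinP; exact: cmeasurable_normc.
have /= := ge0_integral_comp measurable_affine DV affine_scale measurableT mn.
rewrite preimage_setT => ->; last by move=> x _; rewrite lee_fin normc_nneg.
by rewrite lte_mul_pinfty // lee_fin ltW.
Qed.

Lemma cmeasurable_character (xi : Ghat) : cmeasurable [set: borel G] xi.
Proof. by apply: continuous_cmeasurable; exact: character_cont. Qed.

(** The substitution [y = a x - t] contributes the Jacobian [Delta a^-1], which
    turns the factor [sqrt (Delta a)] into its inverse, and splits the character
    at [x = a^-1 (y + t)]. *)
Lemma fourier_dilate f (xi : Ghat) : L1 mG setT f ->
  fourier mG (dilate f) xi = dual_dilate (fourier mG f) xi.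
Proof.
move=> Lf; have [mf ff] := Lf.
rewrite /dual_dilate; set eta := aut_inv _ xi.
pose k (y : G) : R[i] := f y * (eta y)^*%C.
have Lk : L1 mG setT k.
  split.
    apply: cmeasurableM => //; apply: cmeasurable_conj.
    exact: cmeasurable_character.
  rewrite (_ : (fun x => _) = (fun x => (normc (f x))%:E)) //.
  apply/funext => x; rewrite normcM.
  have : normc (eta x)^*%C ^+ 2 = 1.
    by rewrite normc2_conj norm1_normc2 // character_norm.
  by move=> /eqP; rewrite sqrp_eq1 ?normc_nneg // => /eqP ->; rewrite mulr1.
have DV : 0 < (Delta a)^-1 by rewrite invr_gt0.
pose c := (Num.sqrt (Delta a))%:C%C * (eta t)^*%C.
transitivity (cintegral mG setT (fun x => c * k (affine x))).
  rewrite /fourier; congr cintegral; apply/funext => x.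
  rewrite /dilate /c /k -!mulrA; congr (_ * _); rewrite mulrCA; congr (_ * _).
  rewrite -(rmorphM (@conjc R)) -characterD /affine addrC subrK.
  by rewrite /eta /= autK.
have Lkc : L1 mG setT (fun y => c * k y) by exact: L1Z.
rewrite (cintegral_comp measurable_affine DV affine_scale Lkc).
rewrite cintegralZ // /c /fourier -/eta mulrA mulrA mulrA; congr (_ * _ * _).
rewrite -rmorphM /=; congr (_%:C%C).
rewrite -{1}(sqr_sqrtr (ltW D0)) expr2 invfM -mulrA mulVf ?mulr1 //.
by rewrite gt_eqF // sqrtr_gt0.
Qed.

Lemma F_dilate_L1L2 f : L1 mG setT f -> L2 mG setT f ->
  {ae mGhat, forall xi, F (dilate f) xi = dual_dilate (fourier mG f) xi}.
Proof.
move=> L1f L2f.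
have := plancherel_fourier FP (L1_dilate L1f) (L2_dilate L2f).
by apply: ae_mono => xi ->; exact: fourier_dilate.
Qed.

Section dual_side.
Variable (c : R).
Hypotheses (c0 : 0 < c) (chat : forall E : set (borel Ghat), measurable E ->
  mGhat (adjoint R a @` E) = (c%:E * mGhat E)%E).

Let theta : borel Ghat -> borel Ghat := aut_inv (adjoint R a).

Lemma measurable_adjoint_inv : measurable_fun setT theta.
Proof. exact: (measurable_continuous (@aut_inv_cont _ (adjoint R a))). Qed.

Lemma adjoint_inv_scale (E : set (borel Ghat)) : measurable E ->
  mGhat (theta @^-1` E) = (c%:E * mGhat E)%E.
Proof. by move=> mE; rewrite -chat // aut_imageE. Qed.

Let twist (h : Ghat -> R[i]) : Ghat -> R[i] := fun eta => (eta t)^*%C * h eta.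

Let cmeasurable_twist h : cmeasurable [set: borel Ghat] h ->
  cmeasurable [set: borel Ghat] (twist h).
Proof.
move=> mh; apply: cmeasurableM => //; apply: cmeasurable_conj.
by apply: continuous_cmeasurable; exact: (@continuous_evaluation R G t).
Qed.

Lemma cmeasurable_dual_dilate h : cmeasurable [set: borel Ghat] h ->
  cmeasurable [set: borel Ghat] (dual_dilate h).
Proof.
move=> mh; apply: cmeasurableM; first exact: cmeasurable_cst.
have := cmeasurable_comp measurable_adjoint_inv measurableT
  (cmeasurable_twist mh).
by rewrite preimage_setT.
Qed.

Lemma nsq_dual_dilate h : cmeasurable [set: borel Ghat] h ->
  nsq mGhat setT (dual_dilate h) = (((Delta a)^-1 * c)%:E * nsq mGhat setT h)%E.
Proof.
move=> mh.
have mt := cmeasurable_twist mh.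
have mc : cmeasurable [set: borel Ghat] (fun xi => twist h (theta xi)).
  have := cmeasurable_comp measurable_adjoint_inv measurableT mt.
  by rewrite preimage_setT.
have /= := nsqZ mGhat (Num.sqrt (Delta a))^-1%:C%C measurableT mc.
rewrite (_ : _ *: _ = dual_dilate h) // => ->.
have /= := nsq_comp measurable_adjoint_inv c0 adjoint_inv_scale measurableT mt.
rewrite preimage_setT => ->.
rewrite normc_real exprVn sqr_sqrtr ?ltW // muleA -EFinM; congr (_ * _)%E.
apply: eq_integral => xi _; rewrite /twist normc2M normc2_conj.
by rewrite norm1_normc2 ?mul1r // character_norm.
Qed.

(** The adjoint automorphism scales the dual measure, so it preserves null sets
    and [dual_dilate] acts on classes modulo equality almost everywhere. *)
Lemma dual_dilate_ae g h :
  {ae mGhat, forall xi, g xi = h xi} ->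
  {ae mGhat, forall xi, dual_dilate g xi = dual_dilate h xi}.
Proof.
move=> /(ae_comp measurable_adjoint_inv adjoint_inv_scale).
by apply: ae_mono => xi E; rewrite /dual_dilate; congr (_ * (_ * _)).
Qed.

Lemma F_dilate_L1L2_dual f : L1 mG setT f -> L2 mG setT f ->
  {ae mGhat, forall xi, F (dilate f) xi = dual_dilate (F f) xi}.
Proof.
move=> L1f L2f.
have := dual_dilate_ae (plancherel_fourier FP L1f L2f).
move: (F_dilate_L1L2 L1f L2f).
by apply: ae_mono2 => xi -> ->.
Qed.

(** [dilate] and [F] preserve norms, while [dual_dilate] multiplies squared norms
    by [c / Delta a]; comparing at a single nonzero integrable function
    determines [c]. *)
Lemma dual_modulus f : L2 mG setT f -> nsq mG setT f != 0%E -> c = Delta a.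
Proof.
move=> Lf f0.
have [g [L1g L2g g0]] : exists g,
    [/\ L1 mG setT g, L2 mG setT g & nsq mG setT g != 0%E].
  have ff := L2_nsq_fin Lf.
  have f1 : 0 < fine (nsq mG setT f).
    by rewrite fine_gt0 // lt0e f0 nsq_ge0 /= ltey_eq ff.
  have e0 : 0 < fine (nsq mG setT f) / 2 by rewrite divr_gt0.
  have [g [L1g L2g fg]] := L1L2_dense Lf e0; exists g; split => //.
  apply: contraL fg => /eqP g0; rewrite -leNgt.
  have := nsqD mG measurableT (L2B measurableT Lf L2g).1 L2g.1.
  rewrite subrK g0 mule0 adde0 -{1}(fineK ff) => H.
  move: H; rewrite -(fineK (L2_nsq_fin (L2B measurableT Lf L2g))).
  rewrite -EFinM !lee_fin.
  by rewrite ler_pdivrMr // mulrC.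
have mF := (plancherel_L2 FP L2g).1.
have mFd := (plancherel_L2 FP (L2_dilate L2g)).1.
have := plancherel_nsq FP (L2_dilate L2g).
rewrite (nsq_ae measurableT mFd (cmeasurable_dual_dilate mF)); last first.
  by apply: ae_mono (F_dilate_L1L2_dual L1g L2g) => xi + _.
rewrite nsq_dual_dilate // (plancherel_nsq FP L2g) (nsq_dilate L2g.1).
rewrite -(fineK (L2_nsq_fin L2g)) -EFinM => -[] E.
have g1 : fine (nsq mG setT g) != 0 by rewrite fine_eq0 // (L2_nsq_fin L2g).
have {E} : (Delta a)^-1 * c = 1 by apply: (mulIf g1); rewrite E mul1r.
move=> E; apply: (@mulfI _ (Delta a)^-1); first by rewrite invr_eq0 gt_eqF.
by rewrite E mulVf // gt_eqF.
Qed.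

Hypothesis cD : c = Delta a.

(** Both sides depend continuously on [f] in the L2 seminorm and agree on the
    integrable functions, which are dense. *)
Lemma F_dilate f : L2 mG setT f ->
  {ae mGhat, forall xi, F (dilate f) xi = dual_dilate (F f) xi}.
Proof.
move=> Lf.
have mF := (plancherel_L2 FP Lf).1.
have mFd := (plancherel_L2 FP (L2_dilate Lf)).1.
have mD := cmeasurable_dual_dilate mF.
have mB := cmeasurableB mFd mD.
suff /(nsq_eq0 measurableT mB) :
    nsq mGhat setT (F (dilate f) - dual_dilate (F f)) = 0%E.
  by apply: ae_mono => xi /(_ I) /eqP; rewrite !fctE subr_eq0 => /eqP.
apply/eqP; rewrite eq_le nsq_ge0 andbT; apply/lee_addgt0Pr => e e0.
rewrite add0e.
have e4 : 0 < e / 4 by rewrite divr_gt0.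
have [g [L1g L2g fg]] := L1L2_dense Lf e4.
have Lfg := L2B measurableT Lf L2g.
have mFg := (plancherel_L2 FP L2g).1.
have mFdfg := (plancherel_L2 FP (L2_dilate Lfg)).1.
have mFfg := (plancherel_L2 FP Lfg).1.
(* The two operators agree at [g], so only the error [f - g] contributes. *)
have E : {ae mGhat, forall xi, setT xi ->
    (F (dilate f) - dual_dilate (F f)) xi =
    (F (dilate (f - g)) + - dual_dilate (F (f - g))) xi}.
  have E2 := dual_dilate_ae (F_B FP Lf L2g).
  have E1 : {ae mGhat, forall xi,
      F (dilate (f - g)) xi = F (dilate f) xi - F (dilate g) xi}.
    rewrite (_ : dilate (f - g) = dilate f - dilate g).
      exact: F_B (L2_dilate Lf) (L2_dilate L2g).
    by apply/funext => x; rewrite /dilate !fctE mulrBr.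
  have E3 := F_dilate_L1L2_dual L1g L2g.
  move: (ae_mono2 (fun xi => @conj _ _) E1 E2) E3.
  apply: ae_mono2 => xi [{}E1 {}E2] E3 _.
  rewrite !fctE E1 E2 E3 /dual_dilate; ring.
rewrite (nsq_ae measurableT mB _ E); last first.
  by apply: cmeasurableB => //; exact: cmeasurable_dual_dilate.
apply: le_trans (nsqD _ measurableT mFdfg _) _.
  by rewrite -scaleN1r; apply: cmeasurableZ; exact: cmeasurable_dual_dilate.
rewrite nsqN nsq_dual_dilate // (plancherel_nsq FP (L2_dilate Lfg)).
rewrite (plancherel_nsq FP Lfg).
rewrite (nsq_dilate Lfg.1) cD mulVf ?gt_eqF // mul1e.
move: fg; rewrite -(fineK (L2_nsq_fin Lfg)) lte_fin => fg.
by rewrite -!EFinM -EFinD lee_fin; lra.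
Qed.

End dual_side.
End intertwining.

Lemma haar_translation_invariant (R : realType) (G : topologicalZmodType)
    (m : {measure set (borel G) -> \bar R}) :
  haar_measure m -> translation_invariant m.
Proof. by move=> hm x E; exact: haar_translation. Qed.

(** Outer regularity provides an open set of finite measure around [E]. *)
Lemma haar_sigma_finite (R : realType) (G : topologicalZmodType)
    (m : {measure set (borel G) -> \bar R}) (E : set (borel G)) :
  @second_countable G -> haar_measure m ->
  measurable E -> m E != 0%E -> (m E < +oo)%E ->
  sigma_finite setT m.
Proof.
move=> cG hm mE E0 Eoo.
move: (Eoo); rewrite (haar_outer hm mE) => /ereal_inf_lt[_ [V [oV EV] <-] Voo].
apply: (sigma_finite_invariant cG (haar_translation_invariant hm) oV) => //.
apply/set0P; apply: contraNneq E0 => V0.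
by move: EV; rewrite V0 subset0 => ->; rewrite measure0.
Qed.

(** An automorphism and its adjoint have the same modulus. A set [B] of finite
    nonzero measure makes the dual measure sigma-finite, and a function with
    transform the indicator of [B], not being null, identifies the scaling
    constant. *)
Lemma dual_modular (R : realType) (G : topologicalZmodType)
    (mG : {measure set (borel G) -> \bar R})
    (mGhat : {measure set (borel (dual_group R G)) -> \bar R})
    (F : (G -> R[i]) -> (dual_group R G -> R[i])) (Delta : aut G -> R)
    (B : set (borel (dual_group R G))) :
  lca_group G -> @second_countable G ->
  haar_measure mG -> haar_measure mGhat ->
  fourier_plancherel mG mGhat F -> modular_function mG Delta ->
  measurable B -> mGhat B != 0%E -> (mGhat B < +oo)%E ->
  forall a (E : set (borel (dual_group R G))), measurable E ->
    mGhat (adjoint R a @` E) = ((Delta a)%:E * mGhat E)%E.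
Proof.
move=> lG cG hG hGhat FP modD mB B0 Boo a.
have cGhat := @second_countable_dual R G lG cG.
have sm := haar_sigma_finite cGhat hGhat mB B0 Boo.
have [c c0 cE] := automorphism_scaling cGhat (haar_translation_invariant hGhat)
  sm (adjoint R a) mB B0 Boo.
have LB := L2_indic mB Boo.
have [f Lf fB] := plancherel_surj FP LB.
have f0 : nsq mG setT f != 0%E.
  rewrite -(plancherel_nsq FP Lf) (@nsq_ae _ _ _ _ _ _ (fun x => \1_B x));
    rewrite ?nsq_indic //.
  - exact: (plancherel_L2 FP Lf).1.
  - exact: cmeasurable_indic.
  - by apply: ae_mono fB.
have tG := haar_translation_invariant hG.
by rewrite -(dual_modulus FP tG modD 0 c0 cE Lf f0).
Qed.

(** * Wavelets on the tiles of the dual group *)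

Section wavelet_frame.
Variables (R : realType) (G : topologicalZmodType).
Local Notation Ghat := (dual_group R G).
Variables (mGhat : {measure set (borel Ghat) -> \bar R}).
Variables (Delta : aut G -> R) (m : nat).
Hypothesis Delta_gt0 : forall a, 0 < Delta a.
Hypothesis dual_mod : forall a (E : set (borel Ghat)), measurable E ->
  mGhat (adjoint R a @` E) = ((Delta a)%:E * mGhat E)%E.
Variable Omega : 'I_m -> set (borel Ghat).
Hypothesis Omega_measurable : forall i, measurable (Omega i).
Variables (Lambda : 'I_m -> set G) (A : set (aut G)).

Definition tile (s : 'I_m * aut G) : set (borel Ghat) :=
  (aut_inv (adjoint R s.2) : borel Ghat -> borel Ghat) @^-1` Omega s.1.

(** The isometry of L2 of [Omega s.1] onto L2 of the tile [s], extended by zero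
    outside the tile. *)
Definition piece (s : 'I_m * aut G) (k : Ghat -> R[i]) : Ghat -> R[i] :=
  fun xi => (Num.sqrt (Delta s.2))^-1%:C%C *
    restr (Omega s.1) k (aut_inv (adjoint R s.2) xi).

Lemma measurable_tile s : measurable (tile s).
Proof.
rewrite -[X in measurable X]setTI; exact: measurable_adjoint_inv.
Qed.

Lemma piece_out s k xi : ~ tile s xi -> piece s k xi = 0.
Proof. by move=> nt; rewrite /piece restr_out ?mulr0. Qed.

Lemma cmeasurable_piece s k : cmeasurable [set: borel Ghat] k ->
  cmeasurable [set: borel Ghat] (piece s k).
Proof.
move=> mk; apply: cmeasurableM; first exact: cmeasurable_cst.
have := cmeasurable_comp (@measurable_adjoint_inv R G s.2) measurableT
  (cmeasurable_restr (Omega_measurable s.1) mk).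
by rewrite preimage_setT.
Qed.

(** The Jacobian [Delta s.2] of the adjoint cancels the squared normalizing
    factor. *)
Lemma nsq_piece s k : cmeasurable [set: borel Ghat] k ->
  nsq mGhat setT (piece s k) = nsq mGhat (Omega s.1) k.
Proof.
move=> mk; have mr := cmeasurable_restr (Omega_measurable s.1) mk.
have mc : cmeasurable [set: borel Ghat]
    (fun xi => restr (Omega s.1) k (aut_inv (adjoint R s.2) xi)).
  have := cmeasurable_comp (@measurable_adjoint_inv R G s.2) measurableT mr.
  by rewrite preimage_setT.
have /= := nsqZ mGhat (Num.sqrt (Delta s.2))^-1%:C%C measurableT mc.
rewrite (_ : _ *: _ = piece s k) // => ->.
have /= := nsq_comp (@measurable_adjoint_inv R G s.2) (Delta_gt0 s.2)
  (adjoint_inv_scale (@dual_mod s.2)) measurableT mr.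
rewrite preimage_setT => ->.
rewrite normc_real exprVn sqr_sqrtr ?ltW // muleA -EFinM.
by rewrite mulVf ?gt_eqF // mul1e nsq_restr.
Qed.

Lemma piece_sum s (I : Type) (r : seq I) (P : pred I) (k : I -> Ghat -> R[i]) :
  piece s (\sum_(j <- r | P j) k j) = \sum_(j <- r | P j) piece s (k j).
Proof.
apply/funext => xi; rewrite fct_sumE /piece /restr !fct_sumE.
by rewrite mulr_sumr mulr_sumr.
Qed.

Lemma pieceZ s c k : piece s (c *: k) = c *: piece s k.
Proof.
apply/funext => xi; transitivity (c * piece s k xi) => //.
have kE eta : (c *: k) eta = c * k eta by [].
by rewrite /piece /restr kE; ring.
Qed.

Lemma pieceB s k l : piece s (k - l) = piece s k - piece s l.
Proof.
apply/funext => xi; rewrite /piece /restr !fctE; ring.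
Qed.

Definition pull (a : aut G) (h : Ghat -> R[i]) : Ghat -> R[i] :=
  fun eta => (Num.sqrt (Delta a))%:C%C * h (adjoint R a eta).

(** [pull] inverts the isometry [piece], so any function cut down to a tile is a
    piece. *)
Lemma restr_tile s h : restr (tile s) h = piece s (pull s.2 h).
Proof.
apply/funext => xi; have [ts|ts] := pselect (tile s xi).
  rewrite restr_in // /piece restr_in // /pull aut_invK mulrA -rmorphM /=.
  by rewrite mulVf ?mul1r // gt_eqF // sqrtr_gt0.
by rewrite restr_out // piece_out.
Qed.

Lemma cmeasurable_pull a h : cmeasurable [set: borel Ghat] h ->
  cmeasurable [set: borel Ghat] (pull a h).
Proof.
move=> mh; apply: cmeasurableM; first exact: cmeasurable_cst.
have := cmeasurable_comp (measurable_continuous (@aut_cont _ (adjoint R a)))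
  measurableT mh.
by rewrite preimage_setT.
Qed.

Definition conj_evaluation (t : G) : Ghat -> R[i] := fun xi => (xi t)^*%C.

(** The Fourier transforms of the wavelets: conjugate characters transplanted to
    the tiles. *)
Definition dual_wavelet (p : 'I_m * G * aut G) : Ghat -> R[i] :=
  piece (p.1.1, p.2) (conj_evaluation p.1.2).

Lemma cmeasurable_conj_evaluation t :
  cmeasurable [set: borel Ghat] (conj_evaluation t).
Proof.
apply: cmeasurable_conj; apply: continuous_cmeasurable.
exact: (@continuous_evaluation R G t).
Qed.

Lemma dual_waveletE p :
  dual_wavelet p = dual_dilate Delta p.2 p.1.2 (fun xi => \1_(Omega p.1.1) xi).
Proof.
apply/funext => xi.
rewrite /dual_wavelet /piece /dual_dilate /restr /conj_evaluation /=.
by congr (_ * _); rewrite mulrC.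
Qed.

Hypothesis Omega_finite : forall i, (mGhat (Omega i) < +oo)%E.

Lemma L2_dual_wavelet p : L2 mGhat setT (dual_wavelet p).
Proof.
have mc := cmeasurable_conj_evaluation p.1.2.
split; first exact: cmeasurable_piece.
have := nsq_piece (p.1.1, p.2) mc; rewrite /nsq => ->.
rewrite (_ : (fun x => _) = cst 1%E).
  by rewrite integral_cst // mul1e.
by apply/funext => xi; rewrite normc2_conj norm1_normc2 // character_norm.
Qed.

Lemma nsq_conj (D : set (borel Ghat)) (k : Ghat -> R[i]) :
  nsq mGhat D (fun xi => (k xi)^*%C) = nsq mGhat D k.
Proof. by apply: eq_integral => xi _; rewrite normc2_conj. Qed.

Definition key (p : 'I_m * G * aut G) : 'I_m * aut G := (p.1.1, p.2).

Definition fiber (J : {fset 'I_m * G * aut G}) (s : 'I_m * aut G) : {fset G} :=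
  [fset p.1.2 | p in J & key p == s]%fset.

Lemma big_fiber (V : nmodType) (J : {fset 'I_m * G * aut G}) s
    (f : 'I_m * G * aut G -> V) :
  \sum_(t <- fiber J s) f (s.1, t, s.2) = \sum_(p <- J | key p == s) f p.
Proof.
rewrite big_imfset /=; last first.
  move=> [[i t] a] [[i' t'] a']; rewrite !unfold_in /=.
  by move=> /andP[_ /eqP <-] /andP[_ /eqP [-> ->]] ->.
by rewrite big_filter; apply: eq_bigr => -[[i t] a] /= /eqP <-.
Qed.

(** Conjugation turns the [conj_evaluation t] into the characters of the
    spectral pair and leaves norms unchanged. *)
Lemma nsq_dual_wavelet_key (J : {fset 'I_m * G * aut G})
    (c : 'I_m * G * aut G -> R[i]) s :
  nsq mGhat setT (\sum_(p <- J | key p == s) c p *: dual_wavelet p) =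
  nsq mGhat (Omega s.1)
    (\sum_(t <- fiber J s) (c (s.1, t, s.2))^*%C *: evaluation t).
Proof.
rewrite (eq_bigr (fun p => piece s (c p *: conj_evaluation p.1.2))); last first.
  by move=> p /eqP <-; rewrite pieceZ.
rewrite -piece_sum nsq_piece; last first.
  apply: (big_ind (cmeasurable setT)).
  - exact: cmeasurable_cst.
  - by move=> f g; exact: cmeasurableD.
  - by move=> p _; apply: cmeasurableZ; exact: cmeasurable_conj_evaluation.
rewrite -nsq_conj; congr nsq; apply/funext => xi.
rewrite !fct_sumE rmorph_sum /=.
rewrite (big_fiber J s (fun p => ((c p)^*%C *: evaluation p.1.2) xi)).
apply: eq_bigr => p _.
by rewrite [LHS](rmorphM (@conjc R)) /= conjcK.
Qed.

Hypothesis tiling : {ae mGhat, forall xi,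
  (exists2 s, A s.2 & tile s xi) /\
  (forall s s', A s.2 -> A s'.2 -> tile s xi -> tile s' xi -> s = s')}.

(** A combination of dual wavelets splits according to the tiles, which are
    disjoint up to null sets; hence its squared norm is a sum of squared norms
    of combinations of characters. *)
Lemma nsq_dual_wavelet_comb (J : {fset 'I_m * G * aut G})
    (c : 'I_m * G * aut G -> R[i]) :
  (forall p, p \in J -> A p.2) ->
  nsq mGhat setT (\sum_(p <- J) c p *: dual_wavelet p) =
  (\sum_(s <- [fset key p | p in J]%fset) nsq mGhat (Omega s.1)
    (\sum_(t <- fiber J s) (c (s.1, t, s.2))^*%C *: evaluation t))%E.
Proof.
move=> JA; rewrite (partition_big_imfset _ key).
rewrite (@nsq_sum_disjoint _ _ _ _ _ _ tile).
- by apply: eq_bigr => s _; exact: nsq_dual_wavelet_key.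
- move=> s _; apply: (big_ind (cmeasurable setT)).
  + exact: cmeasurable_cst.
  + by move=> f g; exact: cmeasurableD.
  + by move=> p _; apply: cmeasurableZ; exact: (L2_dual_wavelet p).1.
- move=> s xi nt; rewrite fct_sumE big1 // => p /eqP ps.
  rewrite [LHS](_ : _ = c p * dual_wavelet p xi) // /dual_wavelet.
  by rewrite -/(key p) ps piece_out ?mulr0.
- apply: ae_mono tiling => xi [_ uni] s s'.
  move=> /imfsetP[p /= pJ ->] /imfsetP[q /= qJ ->].
  by apply: uni; exact: JA.
Qed.

Lemma L2_evaluation (i : 'I_m) t : L2 mGhat (Omega i) (evaluation t).
Proof.
split.
  have mT : measurable [set: borel Ghat] by [].
  apply: (cmeasurableS mT) => //; apply: continuous_cmeasurable.
  exact: (@continuous_evaluation R G t).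
rewrite (_ : (fun x => _) = cst 1%E).
  by rewrite integral_cst // mul1e.
by apply/funext => xi; rewrite norm1_normc2 // character_norm.
Qed.

Section bounds.
Variables (L U : 'I_m -> R) (Lmin Umax : R).
Hypothesis LminP : forall i, Lmin <= L i.
Hypothesis UmaxP : forall i, U i <= Umax.
Hypothesis LambdaP : forall i (J : {fset G}) (c : G -> R[i]),
  [set` J] `<=` Lambda i ->
  L i * \sum_(t <- J) normc (c t) ^+ 2
    <= l2norm mGhat (Omega i) (\sum_(t <- J) c t *: evaluation t) ^+ 2
    <= U i * \sum_(t <- J) normc (c t) ^+ 2.

(** The bounds of each spectral pair add up over the tiles met by [J]. *)
Lemma dual_wavelet_bounds (J : {fset 'I_m * G * aut G})
    (c : 'I_m * G * aut G -> R[i]) :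
  [set` J] `<=` wavelet_index Lambda A ->
  Lmin * \sum_(p <- J) normc (c p) ^+ 2
    <= fine (nsq mGhat setT (\sum_(p <- J) c p *: dual_wavelet p))
    <= Umax * \sum_(p <- J) normc (c p) ^+ 2.
Proof.
move=> JD; rewrite nsq_dual_wavelet_comb; last by move=> p /JD[].
pose X s := l2norm mGhat (Omega s.1)
  (\sum_(t <- fiber J s) (c (s.1, t, s.2))^*%C *: evaluation t) ^+ 2.
have -> : (\sum_(s <- [fset key p | p in J]%fset) nsq mGhat (Omega s.1)
    (\sum_(t <- fiber J s) (c (s.1, t, s.2))^*%C *: evaluation t) =
    \sum_(s <- [fset key p | p in J]%fset) (X s)%:E)%E.
  apply: eq_bigr => s _; rewrite /X l2norm_sqr fineK //; apply: L2_nsq_fin.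
  by apply: L2_sum => // t _; apply: L2Z => //; exact: L2_evaluation.
rewrite sumEFin /= (partition_big_imfset _ key) /= !mulr_sumr.
have XP s : s \in [fset key p | p in J]%fset ->
    Lmin * (\sum_(p <- J | key p == s) normc (c p) ^+ 2) <= X s <=
    Umax * (\sum_(p <- J | key p == s) normc (c p) ^+ 2).
  move=> _; rewrite -(big_fiber J s (fun p => normc (c p) ^+ 2)).
  have sL : [set` fiber J s] `<=` Lambda s.1.
    move=> t /imfsetP[p] /=; rewrite inE => /andP[pJ /eqP <-] ->.
    by have [] := JD _ pJ.
  have := LambdaP (fun t => (c (s.1, t, s.2))^*%C) sL.
  rewrite (eq_bigr (fun t => normc (c (s.1, t, s.2)) ^+ 2)); last first.
    by move=> t _; rewrite normc2_conj.
  have S0 : 0 <= \sum_(t <- fiber J s) normc (c (s.1, t, s.2)) ^+ 2.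
    by apply: sumr_ge0 => t _; exact: normc2_ge0.
  move=> /andP[lo up]; apply/andP; split.
    by apply: le_trans lo; exact: ler_wpM2r.
  by apply: (le_trans up); exact: ler_wpM2r.
apply/andP; split; rewrite big_seq [leRHS]big_seq; apply: ler_sum => s sS.
  by have /andP[] := XP s sS.
by have /andP[] := XP s sS.
Qed.

End bounds.
Section density.
Hypothesis A_countable : countable A.
Hypothesis Lambda_dense : forall i v, L2 mGhat (Omega i) v ->
  forall e : R, 0 < e -> exists (J : {fset G}) (c : G -> R[i]),
    [set` J] `<=` Lambda i /\
    l2norm mGhat (Omega i) (v - \sum_(t <- J) c t *: evaluation t) < e.

Local Notation approx :=
  (approximable mGhat (wavelet_index Lambda A) dual_wavelet).

(** Pull the function back to [Omega s.1], conjugate it, approximate it there by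
    characters, and transplant the approximation to the tile. *)
Lemma approximable_restr_tile s h : A s.2 -> L2 mGhat setT h ->
  approx (restr (tile s) h).
Proof.
move=> As [mh hoo] e e0; rewrite restr_tile.
pose k := pull s.2 h.
have mk : cmeasurable [set: borel Ghat] k by exact: cmeasurable_pull.
have mT : measurable [set: borel Ghat] by [].
pose v : Ghat -> R[i] := fun eta => (k eta)^*%C.
have mv : cmeasurable [set: borel Ghat] v by exact: cmeasurable_conj.
have Lv : L2 mGhat (Omega s.1) v.
  split; first exact: (cmeasurableS mT).
  rewrite -/(nsq mGhat (Omega s.1) v) nsq_conj -nsq_piece // -restr_tile.
  rewrite nsq_restr; last exact: measurable_tile.
  apply: le_lt_trans hoo; apply: ge0_subset_integral => //.
  - exact: measurable_tile.
  - exact: measurable_normc2.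
  - by move=> x _; rewrite lee_fin normc2_ge0.
have se0 : 0 < Num.sqrt e by rewrite sqrtr_gt0.
have [J [c [JL vJ]]] := Lambda_dense Lv se0.
pose inj (t : G) : 'I_m * G * aut G := (s.1, t, s.2).
exists [fset inj t | t in J]%fset, (fun p => (c p.1.2)^*%C); split.
  by move=> _ /imfsetP[t /= tJ ->]; split => //=; exact: JL.
rewrite big_imfset /=; last by move=> t t' _ _ [].
rewrite (eq_bigr (fun t => piece s ((c t)^*%C *: conj_evaluation t)));
  last first.
  by move=> t _; rewrite pieceZ /dual_wavelet /=; case: (s).
rewrite -piece_sum -pieceB nsq_piece; last first.
  apply: cmeasurableB => //; apply: cmeasurable_sum => t.
  by apply: cmeasurableZ; exact: cmeasurable_conj_evaluation.
rewrite -nsq_conj.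
rewrite (_ : (fun _ => _) = v - \sum_(t <- J) c t *: evaluation t); last first.
  apply/funext => xi; rewrite !fctE !fct_sumE rmorphB rmorph_sum /=.
  congr (_ - _).
  apply: eq_bigr => t _; rewrite [LHS](rmorphM (@conjc R)) /= conjcK.
  by rewrite /conj_evaluation conjcK.
have Lr : L2 mGhat (Omega s.1) (v - \sum_(t <- J) c t *: evaluation t).
  apply: L2B => //; apply: L2_sum => // t _; apply: L2Z => //.
  exact: L2_evaluation.
rewrite -(fineK (L2_nsq_fin Lr)) lte_fin -l2norm_sqr.
rewrite -[e]sqr_sqrtr ?ltW // ltr_pXn2r ?nnegrE //; exact: sqrtr_ge0.
Qed.

(** Finitely many tiles carry almost all of the squared norm of [h], and on each
    of them [h] is approximable. *)
Lemma approximable_dual_wavelet h : L2 mGhat setT h -> approx h.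
Proof.
move=> Lh.
have xL2 p : wavelet_index Lambda A p -> L2 mGhat setT (dual_wavelet p).
  by move=> _; exact: L2_dual_wavelet.
have [[s0 As0]|noA] := pselect (exists s : 'I_m * aut G, A s.2); last first.
  apply: (approximable_ae xL2 (L2_0 mGhat setT).1 Lh.1 _ (approximable0 _ _ _)).
  by apply: ae_mono tiling => xi [[s As _] _]; exfalso; apply: noA; exists s.
have cK : countable [set s : 'I_m * aut G | A s.2].
  have := countableX (countableP [set: 'I_m]) A_countable.
  by congr countable; apply/seteqP; split=> s //= [].
have [e eK] := countable_enum cK As0.
have eA n : A (e n).2.
  by have : [set s : 'I_m * aut G | A s.2] (e n) by rewrite eK; exists n.
pose S n := [fset e k | k in iota 0 n]%fset.
have SA n s : s \in S n -> A s.2 by move=> /imfsetP[k _ ->].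
pose B n := \bigcup_(s in [set` S n]) tile s.
have mB n : measurable (B n).
  by apply: fin_bigcup_measurable => // s _; exact: measurable_tile.
have Lr s : L2 mGhat setT (restr (tile s) h).
  split; first by apply: cmeasurable_restr (measurable_tile s) Lh.1.
  rewrite -/(nsq mGhat setT (restr (tile s) h)) nsq_restr; last first.
    exact: measurable_tile.
  apply: le_lt_trans Lh.2; apply: ge0_subset_integral => //.
  - exact: measurable_tile.
  - exact: measurable_normc2 Lh.1.
  - by move=> x _; rewrite lee_fin normc2_ge0.
apply: (approximable_lim xL2) => // eps eps0.
have [|n nE] := L2_exhaustion mB Lh _ eps0.
  apply: ae_mono tiling => xi [[s As ts] _].
  have : [set s : 'I_m * aut G | A s.2] s by [].
  rewrite eK => -[k _ ks]; exists k.+1 => n kn; left.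
  exists s => //=; apply/imfsetP; exists k => //=.
  by rewrite mem_iota add0n.
(* Restricting to finitely many tiles is summing the restrictions, up to a null
   set on which the tiles may overlap. *)
have sumE : {ae mGhat, forall xi,
    restr (B n) h xi = (\sum_(s <- S n) restr (tile s) h) xi}.
  apply: ae_mono tiling => xi [_ uni]; rewrite fct_sumE.
  have [[s /= sS ts]|nB] := pselect (B n xi).
    rewrite restr_in; last by exists s.
    rewrite (big_fsetD1 s) //= restr_in // big_seq big1 ?addr0 //.
    move=> s'; rewrite !inE => /andP[s's s'S]; apply: restr_out => ts'.
    by move/eqP: s's; apply; apply: uni => //; apply: (SA n).
  rewrite restr_out // big_seq big1 // => s sS; apply: restr_out => ts.
  by apply: nB; exists s.
exists (\sum_(s <- S n) restr (tile s) h); split.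
- by apply: L2_sum.
- apply: (approximable_sum xL2) => s sS; split => //.
  by apply: approximable_restr_tile => //; exact: (SA n).
- rewrite -(@nsq_ae _ _ _ _ _ (h - restr (B n) h)) //.
  + apply: cmeasurableB; first exact: Lh.1.
    by apply: cmeasurable_restr => //; exact: Lh.1.
  + apply: cmeasurableB; first exact: Lh.1.
    by apply: cmeasurable_sum => s; exact: (Lr s).1.
  + by apply: ae_mono sumE => xi E _; rewrite !fctE E.
Qed.

End density.
End wavelet_frame.

(** A sum of zeros and ones equals [1] when exactly one term does, which singles
    out [a]; the [Omega i] being disjoint, [i] is then unique as well. *)
Lemma tilingP (R : realType) (G : topologicalZmodType)
    (mu : {measure set (borel (dual_group R G)) -> \bar R}) (m : nat)
    (Omega : 'I_m -> set (borel (dual_group R G))) (A : set (aut G)) :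
  trivIset [set: 'I_m] Omega ->
  multiplicative_tiling mu (\bigcup_i Omega i) A ->
  {ae mu, forall xi,
    (exists2 s, A s.2 & tile Omega s xi) /\
    (forall s s', A s.2 -> A s'.2 ->
       tile Omega s xi -> tile Omega s' xi -> s = s')}.
Proof.
move=> dO; apply: ae_mono => xi.
have inT a : (adjoint R a @` (\bigcup_i Omega i)) xi <->
    exists i, tile Omega (i, a) xi.
  rewrite aut_imageE; split; first by move=> [i _ Oi]; exists i.
  by move=> [i Oi]; exists i.
set f := fun a => _; move=> fE.
have f0 a : (0 <= f a)%E by rewrite /f lee_fin.
have f1 a i : tile Omega (i, a) xi -> f a = 1%E.
  by move=> ti; rewrite /f indicE mem_set //; apply/inT; exists i.
split.
  have [//|no] := pselect (exists2 s, A s.2 & tile Omega s xi).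
  move: fE; rewrite esum1 => [/eqP|a Aa]; first by rewrite eqe eq_sym oner_eq0.
  rewrite /f indicE memNset // => /inT[i ti]; apply: no.
  by exists (i, a).
move=> [i a] [j b] /= Aa Ab ti tj.
have ab : a = b.
  apply/eqP; apply: contraT => nab.
  have : (2%:E <= \esum_(a in A) f a)%E.
    apply: esum_ge; exists [set` [fset a; b]%fset].
      split; first exact: finite_fset.
      by move=> x /=; rewrite !inE => /orP[/eqP->|/eqP->].
    rewrite fsbig_finite; last exact: finite_fset.
    by rewrite set_fsetK big_fsetU1 ?inE //= big_seq_fset1 (f1 a i) // (f1 b j).
  by rewrite fE lee_fin leNgt ltr1n.
subst b; congr pair; apply: (dO i j) => //.
by exists (aut_inv (adjoint R a) xi).
Qed.

(** * The wavelet basis *)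

Theorem theorem2p4 (R : realType) (G : topologicalZmodType)
    (G_lca : lca_group G)
    (G_infinite : infinite_set [set: G])
    (G_nondiscrete : ~ discrete_space G)
    (G_second_countable : @second_countable G)
    (G_lattice : exists Gamma : zmodClosed G, is_lattice Gamma)
    (mG : {measure set (borel G) -> \bar R})
    (mGhat : {measure set (borel (dual_group R G)) -> \bar R})
    (mG_haar : haar_measure mG)
    (mGhat_haar : haar_measure mGhat)
    (F : (G -> R[i]) -> (dual_group R G -> R[i]))
    (F_plancherel : fourier_plancherel mG mGhat F)
    (Delta : aut G -> R)
    (Delta_modular : modular_function mG Delta)
    (Delta_nontrivial : exists a : aut G, Delta a != 1)
    (m : nat)
    (Omega : 'I_m.+1 -> set (borel (dual_group R G)))
    (Omega_disjoint : trivIset [set: 'I_m.+1] Omega)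
    (Omega_measurable : forall i, measurable (Omega i))
    (Omega_finite : forall i, (mGhat (Omega i) < +oo)%E)
    (Omega_neq0 : forall i, mGhat (Omega i) != 0%E)
    (Lambda : 'I_m.+1 -> set G)
    (Lambda_countable : forall i, countable (Lambda i))
    (L U : 'I_m.+1 -> R)
    (Omega_Lambda : forall i,
      riesz_spectral_pair mGhat (Omega i) (Lambda i) (L i) (U i))
    (A : set (aut G))
    (A_countable : countable A)
    (A_tiling :
      multiplicative_tiling mGhat (\bigcup_(i : 'I_m.+1) Omega i) A) :
  riesz_wavelet_collection mG mGhat F Delta Omega /\
  forall psi : 'I_m.+1 -> G -> R[i],
    wavelet_generators mG mGhat F Omega psi ->
    riesz_basis (L2 mG [set: borel G]) (l2norm mG [set: borel G])
      (wavelet_index Lambda A) (wavelet Delta psi)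
      (\big[Num.min/L ord0]_(i < m.+1) L i)
      (\big[Num.max/U ord0]_(i < m.+1) U i).
Proof.
have Delta_gt0 a : 0 < Delta a by have [] := Delta_modular a.
have tG := haar_translation_invariant mG_haar.
have dual_mod := dual_modular G_lca G_second_countable mG_haar mGhat_haar
  F_plancherel Delta_modular (Omega_measurable ord0) (Omega_neq0 ord0)
  (Omega_finite ord0).
have tiling := tilingP Omega_disjoint A_tiling.
have basis psi : wavelet_generators mG mGhat F Omega psi ->
    riesz_basis (L2 mG [set: borel G]) (l2norm mG [set: borel G])
      (wavelet_index Lambda A) (wavelet Delta psi)
      (\big[Num.min/L ord0]_(i < m.+1) L i)
      (\big[Num.max/U ord0]_(i < m.+1) U i).
  move=> gen.
  have LminP i : \big[Num.min/L ord0]_(j < m.+1) L j <= L i by exact: bigmin_le.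
  have UmaxP i : U i <= \big[Num.max/U ord0]_(j < m.+1) U j by exact: le_bigmax.
  have Lwavelet p : L2 mG setT (wavelet Delta psi p).
    exact: (L2_dilate tG Delta_modular p.2 p.1.2 (gen p.1.1).1).
  have Ldual := L2_dual_wavelet Delta_gt0 dual_mod Omega_measurable
    Omega_finite.
  have Fwavelet p : {ae mGhat, forall xi,
      F (wavelet Delta psi p) xi = dual_wavelet Delta Omega p xi}.
    have [Lpsi Fpsi] := gen p.1.1.
    have := F_dilate F_plancherel tG Delta_modular p.1.2 (Delta_gt0 p.2)
       (dual_mod p.2) erefl Lpsi.
    have := dual_dilate_ae Delta p.1.2 (dual_mod p.2) Fpsi.
    by apply: ae_mono2 => xi E1 E2; rewrite dual_waveletE -E1 -E2.
  have Fcomb (J : {fset 'I_m.+1 * G * aut G}) c : {ae mGhat, forall xi,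
      F (\sum_(p <- J) c p *: wavelet Delta psi p) xi =
      (\sum_(p <- J) c p *: dual_wavelet Delta Omega p) xi}.
    have FS := F_sum F_plancherel c
      (fun p (_ : p \in enum_fset J) => Lwavelet p).
    move: (ae_seq (enum_fset J) Fwavelet) FS; apply: ae_mono2 => xi FJ ->.
    by rewrite fct_sumE; apply: eq_big_seq => p pJ; rewrite FJ.
  have Lcomb (J : {fset 'I_m.+1 * G * aut G}) c :
      L2 mG setT (\sum_(p <- J) c p *: wavelet Delta psi p).
    by apply: L2_sum => // p _; exact: L2Z.
  split.
  - apply/andP; split.
      apply: (big_ind (fun x => 0 < x)) => [|x y x0 y0|i _].
      + by have [_ _ _ [/andP[]]] := Omega_Lambda ord0.
      + by rewrite lt_min x0.
      + by have [_ _ _ [/andP[]]] := Omega_Lambda i.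
    apply: le_trans (LminP ord0) (le_trans _ (UmaxP ord0)).
    by have [_ _ _ [/andP[]]] := Omega_Lambda ord0.
  - have cL : countable (\bigcup_i Lambda i).
      by apply: bigcup_countable => //; exact: countableP.
    have := countableX (countableX (countableP [set: 'I_m.+1]) cL) A_countable.
    apply: sub_countable; apply: subset_card_le => p [Lp Ap]; split => //.
    by split => //; exists p.1.1.
  - by move=> p _; exact: Lwavelet.
  - move=> v Lv e e0.
    have Lh := plancherel_L2 F_plancherel Lv.
    have dense i w : L2 mGhat (Omega i) w -> forall r : R, 0 < r ->
        exists (J : {fset G}) (c : G -> R[i]), [set` J] `<=` Lambda i /\
        l2norm mGhat (Omega i) (w - \sum_(t <- J) c t *: evaluation t) < r.
      by have [_ _ _ [_ _ _ + _]] := Omega_Lambda i; apply.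
    have e2 : 0 < e ^+ 2 by rewrite exprn_gt0.
    have [J [c [JD JE]]] := approximable_dual_wavelet Delta_gt0 dual_mod
      Omega_measurable Omega_finite tiling A_countable dense Lh e2.
    exists J, c; split => //.
    have Ld := L2B measurableT Lv (Lcomb J c).
    rewrite -(@ltr_pXn2r _ 2) ?nnegrE ?sqrtr_ge0 ?ltW //.
    rewrite l2norm_sqr -lte_fin fineK; last exact: L2_nsq_fin.
    rewrite -(plancherel_nsq F_plancherel Ld).
    rewrite (@nsq_ae _ (borel (dual_group R G)) R _ _ _
      (F v - \sum_(p <- J) c p *: dual_wavelet Delta Omega p)) //.
    + exact: (plancherel_L2 F_plancherel Ld).1.
    + apply: cmeasurableB; first exact: Lh.1.
      apply: cmeasurable_sum => p; apply: cmeasurableZ.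
      exact: (Ldual p).1.
    + move: (F_B F_plancherel Lv (Lcomb J c)) (Fcomb J c).
      by apply: ae_mono2 => xi E1 E2 _; rewrite E1 E2.
  - move=> J c JD.
    rewrite l2norm_sqr -(plancherel_nsq F_plancherel (Lcomb J c)).
    rewrite (@nsq_ae _ (borel (dual_group R G)) R _ _ _
      (\sum_(p <- J) c p *: dual_wavelet Delta Omega p)) //.
    + apply: (dual_wavelet_bounds Delta_gt0 dual_mod Omega_measurable
        Omega_finite tiling LminP UmaxP _ c JD) => i K b KL.
      by have [_ _ _ [_ _ _ _ +]] := Omega_Lambda i; apply.
    + exact: (plancherel_L2 F_plancherel (Lcomb J c)).1.
    + apply: cmeasurable_sum => p; apply: cmeasurableZ.
      exact: (Ldual p).1.
    + by apply: ae_mono (Fcomb J c).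
split; last exact: basis.
split; first exact: Omega_measurable.
have /choice[psi gen] : forall i, exists f, L2 mG setT f /\
    {ae mGhat, forall xi, F f xi = \1_(Omega i) xi}.
  move=> i; have [f Lf Ff] := plancherel_surj F_plancherel
    (L2_indic (Omega_measurable i) (Omega_finite i)).
  by exists f; split.
exists A, Lambda, psi, (\big[Num.min/L ord0]_(i < m.+1) L i),
  (\big[Num.max/U ord0]_(i < m.+1) U i).
by split; [exact: A_countable|exact: Lambda_countable|exact: gen|exact: basis].
Qed.
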